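(* Let $\beta\in(0,\pi)$, $\theta\in\mathbb{R}$, and let $f_\beta=h_\beta+\overline{g_\beta}\in K_H^0$ be a harmonic mapping of $E$ with $$h_\beta(z)+g_\beta(z)=\frac{1}{2i\sin\beta}\log\left(\frac{1+ze^{i\beta}}{1+ze^{-i\beta}}\right)$$ and with dilatation $\omega_1(z)=g_\beta'(z)/h_\beta'(z)=e^{i\theta}z$. Let $F_a=H_a+\overline{G_a}$ be the right half-plane mapping with $$H_a(z)=\frac{\frac{1}{1+a}z-\frac12z^2}{(1-z)^2},\qquad G_a(z)=\frac{\frac{a}{1+a}z-\frac12z^2}{(1-z)^2}.$$ Then, for $a\in[-\tfrac13,1)$, the harmonic convolution $F_a\ast f_\beta$ belongs to $S_H^0$ and is convex in the direction of the real axis.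
   Context: $E=\{z\in\mathbb{C}:|z|<1\}$. $S_H$ is the class of all harmonic, sense-preserving, univalent mappings $f=h+\overline{g}$ in $E$ ($h,g$ analytic in $E$, with $h(0)=g(0)=0$) normalized by $f(0)=0$ and $f_z(0)=1$. $S_H^0$ is the subclass of $f\in S_H$ with $f_{\overline z}(0)=0$. $K_H^0$ is the subclass of $S_H^0$ consisting of functions that map $E$ onto convex domains. The dilatation of $f=h+\overline{g}$ is $\omega=g'/h'$. The logarithm is the analytic branch on $E$ vanishing at $z=0$. The harmonic convolution of $F=H+\overline{G}$ and $f=h+\overline{g}$ is $F\ast f=H\ast h+\overline{G\ast g}$, where for power series $\sum_{n\ge1} A_nz^n$ and $\sum_{n\ge1} a_nz^n$ analytic in $E$ the Hadamard product is $\sum_{n\ge1} A_na_nz^n$. A domain $\Omega$ is convex in a direction $\phi$, $0\le\phi<\pi$, if every line parallel to the line joining $0$ and $e^{i\phi}$ has a connected intersection with $\Omega$. A univalent mapping of $E$ is convex in the direction of the real axis if its image of $E$ is convex in the direction $\phi=0$. The mapping $F_a$, $a\in(-1,1)$, satisfies $H_a(z)+G_a(z)=z/(1-z)$ and has dilatation $G_a'(z)/H_a'(z)=(a-z)/(1-az)$.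
   Formalization: Membership in S_H^0 is asserted for (1+a)(F_a∗f_β) instead of F_a∗f_β, because F_a∗f_β has f_z(0)=1/(1+a), which is not 1 unless a=0; convexity in the direction of the real axis is stated for F_a∗f_β itself. *)

(* Defs.v *)
From Stdlib Require Import Reals Factorial.
From Coquelicot Require Import Coquelicot.

Open Scope R_scope.

Definition E (z : C) : Prop := Cmod z < 1.

Definition Cexp (z : C) : C := (exp (Re z) * (cos (Im z), sin (Im z)))%C.

Definition analytic (f : C -> C) : Prop :=
  forall z : C, E z -> ex_derive (K := C_AbsRing) (V := C_NormedModule) f z.

(* The analytic branch on E of log u that vanishes at 0. *)
Definition is_log_branch (u L : C -> C) : Prop :=
  analytic L /\ L (RtoC 0) = RtoC 0 /\
  forall z : C, E z -> Cexp (L z) = u z.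

(* A harmonic mapping f = h + conj g is handled through the pair (h, g), which
   f determines on E because h(0) = g(0) = 0. *)
Definition harm (h g : C -> C) (z : C) : C := (h z + Cconj (g z))%C.

(* For f = h + conj g one has f_z = h' and f_zbar = conj g', so the Jacobian
   of f is |h'|^2 - |g'|^2. *)
Definition sense_preserving (h g : C -> C) : Prop :=
  forall z : C, E z -> Cmod (C_derive g z) < Cmod (C_derive h z).

Definition univalent (f : C -> C) : Prop :=
  forall z w : C, E z -> E w -> f z = f w -> z = w.

Record SH (h g : C -> C) : Prop := {
  SH_analytic_h : analytic h;
  SH_analytic_g : analytic g;
  SH_h0 : h (RtoC 0) = RtoC 0;
  SH_g0 : g (RtoC 0) = RtoC 0;
  SH_sense_preserving : sense_preserving h g;
  SH_univalent : univalent (harm h g);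
  SH_normalized : C_derive h (RtoC 0) = RtoC 1
}.

Definition SH0 (h g : C -> C) : Prop :=
  SH h g /\ Cconj (C_derive g (RtoC 0)) = RtoC 0.

Definition image_E (f : C -> C) (w : C) : Prop := exists z : C, E z /\ f z = w.

Definition convex_set (A : C -> Prop) : Prop :=
  forall (p q : C) (t : R), A p -> A q -> 0 <= t <= 1 ->
    A (RtoC (1 - t) * p + RtoC t * q)%C.

(* Openness and connectedness of the image are automatic for members of S_H,
   so "convex domain" is expressed by convexity alone. *)
Definition KH0 (h g : C -> C) : Prop :=
  SH0 h g /\ convex_set (image_E (harm h g)).

Definition connected_set (A : C -> Prop) : Prop :=
  forall U V : C -> Prop,
    open (T := C_UniformSpace) U -> open (T := C_UniformSpace) V ->
    (forall z, A z -> U z \/ V z) ->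
    (exists z, A z /\ U z) -> (exists z, A z /\ V z) ->
    exists z, A z /\ U z /\ V z.

Definition line (phi : R) (p w : C) : Prop :=
  exists t : R, w = (p + RtoC t * Cexp (Ci * RtoC phi))%C.

Definition convex_in_direction (phi : R) (A : C -> Prop) : Prop :=
  forall p : C, connected_set (fun w => A w /\ line phi p w).

Definition convex_in_real_direction (f : C -> C) : Prop :=
  convex_in_direction 0 (image_E f).

Definition taylor (f : C -> C) (n : nat) : C :=
  (Nat.iter n C_derive f (RtoC 0) / RtoC (INR (fact n)))%C.

Definition CSeries (u : nat -> C) : C :=
  (Series (fun n => Re (u n)), Series (fun n => Im (u n))).

(* The sum starts at the coefficient of z. *)
Definition hadamard (F f : C -> C) (z : C) : C :=
  CSeries (fun n => taylor F (S n) * taylor f (S n) * z ^ S n)%C.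

Definition hconv (H G h g : C -> C) : C -> C :=
  harm (hadamard H h) (hadamard G g).

(* H_a'(0) = 1 / (1 + a), so for h'(0) = 1 the convolution of F_a with
   h + conj g has f_z(0) = 1 / (1 + a).  Multiplying it by the positive constant
   1 + a gives the mapping with f_z(0) = 1. *)
Definition Ha (a : R) (z : C) : C :=
  ((RtoC (1 / (1 + a)) * z - RtoC (1 / 2) * z ^ 2) / (RtoC 1 - z) ^ 2)%C.

Definition Ga (a : R) (z : C) : C :=
  ((RtoC (a / (1 + a)) * z - RtoC (1 / 2) * z ^ 2) / (RtoC 1 - z) ^ 2)%C.

Definition scale (c : R) (f : C -> C) (z : C) : C := (RtoC c * f z)%C.

(* Main.v *)
Require Import Defs.
From Stdlib Require Import Reals Factorial Lra Lia Classical ClassicalEpsilon.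
From Coquelicot Require Import Coquelicot.
Open Scope R_scope.

(** Convolving with F_a only multiplies the n-th Taylor coefficient by an affine
function of n, so F_a * f = H + conj G with
   H = lam z h' + mu h,   G = mu g - lam z g',
where mu = 1/2 and lam = (1-a)/(2(1+a)), and a >= -1/3 says exactly that
lam <= 2 mu.  Differentiating the logarithm gives, with k = e^(i beta),
k' = conj k and eps = e^(i theta),
   h' = 1 / ((1 + k z)(1 + k' z)(1 + eps z)),   g' = eps z h',
products of geometric series, so that h and g are power series on E whose Taylor
coefficients are found without Cauchy's theorem.

Sense-preservation.  One has z h''/h' = 1/(1+kz) + 1/(1+k'z) + 1/(1+eps z) - 3,
and each fraction has real part > 1/2 on the disk.  Writing H' = h' Y, this gives
Re Y > (2 mu - lam)/2, while G' = eps z h' (2 mu - lam - Y).  As 2 mu - lam >= 0,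
the point Y is at least as close to 2 mu - lam as to 0, so |G'| < |H'|
([conv_sense_preserving]).

Univalence and convexity.  This is Clunie and Sheil-Small's shear construction,
carried out in a coordinate w in which it becomes elementary.  The map
[strip_map] carries the strip |Im w| < pi/2 onto the disk and
   (H - G)' = P(z) / ((1 + k z)(1 + k' z)),   Re P > 0,
becomes: the w-derivative of i (H - G) has positive real part.  Hence the real
part of i (H - G), which is minus the imaginary part of H + conj G, increases
along every horizontal line of the strip, and it runs from -oo to +oo because
one summand is a positive multiple of sinh (Re w) cos (Im w)
([Re_shear_w_split]).  So each level set of Im (H + conj G) is a graph over Im w.
Along that graph H - G has real increments; as Re ((H' + G') / (H' - G')) > 0,
the real part of H + conj G, equal to that of H + G, increases with Im w
([level_increasing]).  A level set is thus mapped injectively onto an interval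
of a horizontal line ([strip_injective], [strip_level_connected]), which is both
univalence and convexity in the direction of the real axis. *)

(** * Complex derivatives *)

(** C is normed in two ways, with square balls as a product and with discs as a valued
    ring.  Stating the limit with the modulus mediates between the two. *)
Definition has_cderiv (f : C -> C) (z l : C) : Prop :=
  forall eps, 0 < eps -> exists d, 0 < d /\ forall y, Cmod (y - z)%C < d ->
    Cmod (f y - f z - l * (y - z))%C <= eps * Cmod (y - z)%C.

Lemma has_cderiv_is_derive f z l :
  has_cderiv f z l <-> is_derive (K := C_AbsRing) (V := C_NormedModule) f z l.
Proof.
assert (E0 : forall y, (minus (minus (f y) (f z)) (scal (V := C_NormedModule) (minus (G := C_AbsRing) y z) l) : C)
  = (f y - f z - l * (y - z))%C).
{ intros y. unfold minus, plus, opp, scal; simpl. unfold mult; simpl. ring. }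
split.
- intros H. split. apply is_linear_scal_l.
  intros x Hx. apply (is_filter_lim_locally_unique (V := AbsRing_NormedModule C_AbsRing)) in Hx. subst x.
  intros eps. destruct (H eps (cond_pos eps)) as [d [Hd H1]].
  exists (mkposreal d Hd). intros y Hy. specialize (H1 y Hy).
  rewrite <- E0 in H1. exact H1.
- intros [_ H] eps Heps.
  destruct (H z (fun P HP => HP) (mkposreal eps Heps)) as [d H1].
  exists d. split. apply cond_pos. intros y Hy. specialize (H1 y Hy).
  rewrite <- E0. exact H1.
Qed.

Lemma has_cderiv_is_derive_ring f z l :
  has_cderiv f z l <-> is_derive (K := C_AbsRing) (V := AbsRing_NormedModule C_AbsRing) f z l.
Proof.
rewrite has_cderiv_is_derive.
split; intros [_ H]; (split; [apply is_linear_scal_l | exact H]).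
Qed.

Lemma has_cderiv_C_derive f z l : has_cderiv f z l -> C_derive f z = l.
Proof. intros H. apply is_C_derive_unique. now apply has_cderiv_is_derive. Qed.

Lemma ex_derive_has_cderiv f z :
  ex_derive (K := C_AbsRing) (V := C_NormedModule) f z -> has_cderiv f z (C_derive f z).
Proof.
intros [l H]. apply has_cderiv_is_derive in H.
now rewrite (has_cderiv_C_derive _ _ _ H).
Qed.

Lemma has_cderiv_ext_ball f g z l d :
  0 < d -> (forall y, Cmod (y - z)%C < d -> f y = g y) -> has_cderiv f z l -> has_cderiv g z l.
Proof.
intros Hd Hfg H eps He. destruct (H eps He) as [d1 [Hd1 H1]].
exists (Rmin d d1). split. now apply Rmin_pos.
intros y Hy.
rewrite <- (Hfg y), <- (Hfg z). apply H1.
apply Rlt_le_trans with (1 := Hy), Rmin_r.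
replace (z - z)%C with (RtoC 0) by ring. now rewrite Cmod_0.
apply Rlt_le_trans with (1 := Hy), Rmin_l.
Qed.

Lemma has_cderiv_const c z : has_cderiv (fun _ => c) z (RtoC 0).
Proof.
intros eps He. exists 1. split. lra. intros y _.
replace (c - c - 0 * (y - z))%C with (RtoC 0) by ring. rewrite Cmod_0.
apply Rmult_le_pos. lra. apply Cmod_ge_0.
Qed.

Lemma has_cderiv_id z : has_cderiv (fun x => x) z (RtoC 1).
Proof.
intros eps He. exists 1. split. lra. intros y _.
replace (y - z - 1 * (y - z))%C with (RtoC 0) by ring. rewrite Cmod_0.
apply Rmult_le_pos. lra. apply Cmod_ge_0.
Qed.

Lemma has_cderiv_plus f g z lf lg :
  has_cderiv f z lf -> has_cderiv g z lg -> has_cderiv (fun x => f x + g x)%C z (lf + lg)%C.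
Proof.
rewrite !has_cderiv_is_derive. intros Hf Hg.
exact (is_derive_plus (K := C_AbsRing) (V := C_NormedModule) f g z lf lg Hf Hg).
Qed.

Lemma has_cderiv_lipschitz f z l : has_cderiv f z l ->
  exists M d, 0 < M /\ 0 < d /\ forall y, Cmod (y - z)%C < d -> Cmod (f y - f z)%C <= M * Cmod (y - z)%C.
Proof.
intros H. destruct (H 1 Rlt_0_1) as [d [Hd H1]].
exists (1 + Cmod l), d. pose proof (Cmod_ge_0 l). split. lra. split. easy.
intros y Hy. replace (f y - f z)%C with ((f y - f z - l * (y - z)) + l * (y - z))%C by ring.
eapply Rle_trans. apply Cmod_triangle. rewrite Cmod_mult. specialize (H1 y Hy). lra.
Qed.

Lemma has_cderiv_mult f g z lf lg :
  has_cderiv f z lf -> has_cderiv g z lg -> has_cderiv (fun x => f x * g x)%C z (lf * g z + f z * lg)%C.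
Proof.
rewrite !has_cderiv_is_derive_ring. intros Hf Hg.
exact (is_derive_mult (K := C_AbsRing) f g z lf lg Hf Hg Cmult_comm).
Qed.

Lemma has_cderiv_comp f g z lf lg :
  has_cderiv f (g z) lf -> has_cderiv g z lg -> has_cderiv (fun x => f (g x)) z (lf * lg)%C.
Proof.
intros Hf Hg. rewrite Cmult_comm.
apply has_cderiv_is_derive_ring in Hg. apply has_cderiv_is_derive. apply has_cderiv_is_derive in Hf.
exact (is_derive_comp (K := C_AbsRing) (V := C_NormedModule) f g z lf lg Hf Hg).
Qed.

Lemma has_cderiv_scal c f z l : has_cderiv f z l -> has_cderiv (fun x => c * f x)%C z (c * l)%C.
Proof.
intros H. replace (c * l)%C with (0 * f z + c * l)%C by ring.
apply (has_cderiv_mult (fun _ => c)). apply has_cderiv_const. exact H.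
Qed.

Lemma has_cderiv_minus f g z lf lg :
  has_cderiv f z lf -> has_cderiv g z lg -> has_cderiv (fun x => f x - g x)%C z (lf - lg)%C.
Proof.
intros Hf Hg. apply (has_cderiv_ext_ball (fun x => f x + (- (1)) * g x)%C _ _ _ 1).
lra. intros; ring.
replace (lf - lg)%C with (lf + (- (1)) * lg)%C by ring.
apply has_cderiv_plus. exact Hf. now apply has_cderiv_scal.
Qed.

Lemma has_cderiv_inv z : z <> RtoC 0 -> has_cderiv (fun x => / x)%C z (- / (z * z))%C.
Proof.
intros Hz eps He. pose proof (proj1 (Cmod_gt_0 z) Hz) as Hm.
set (m := Cmod z) in *.
exists (Rmin (m / 2) (eps * (m * m * m) / 2)).
assert (0 < m * m * m) by (repeat apply Rmult_lt_0_compat; auto).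
split. apply Rmin_pos; nra.
intros y Hy.
assert (H1 : Cmod (y - z)%C < m / 2) by (apply Rlt_le_trans with (1 := Hy), Rmin_l).
assert (H2 : Cmod (y - z)%C < eps * (m * m * m) / 2) by (apply Rlt_le_trans with (1 := Hy), Rmin_r).
assert (Hy1 : m / 2 <= Cmod y).
{ pose proof (Cmod_triangle y (- (y - z))%C) as T. rewrite Cmod_opp in T.
  replace (y + - (y - z))%C with z in T by ring. fold m in T. lra. }
assert (y <> RtoC 0) by (apply Cmod_gt_0; lra).
replace (/ y - / z - - / (z * z) * (y - z))%C with ((y - z) * (y - z) * / (y * (z * z)))%C by (field; auto).
rewrite !Cmod_mult, Cmod_inv, !Cmod_mult by (repeat apply Cmult_neq_0; auto). fold m.
set (t := Cmod (y - z)%C) in *. assert (0 <= t) by apply Cmod_ge_0.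
rewrite Rmult_assoc, Rmult_comm. apply Rmult_le_compat_r. auto.
apply Rmult_le_reg_r with (Cmod y * (m * m)). nra.
rewrite Rmult_assoc, Rinv_l by nra. nra.
Qed.

Lemma has_cderiv_linear_factor al z : has_cderiv (fun x => 1 + al * x)%C z al.
Proof.
pose proof (has_cderiv_plus _ _ z _ _ (has_cderiv_const 1 z) (has_cderiv_scal al _ _ _ (has_cderiv_id z))) as D.
replace (0 + al * 1)%C with al in D by ring. exact D.
Qed.

Lemma has_cderiv_div f g z lf lg : g z <> RtoC 0 ->
  has_cderiv f z lf -> has_cderiv g z lg ->
  has_cderiv (fun x => f x / g x)%C z ((lf * g z - f z * lg) / (g z * g z))%C.
Proof.
intros Hz Hf Hg.
replace ((lf * g z - f z * lg) / (g z * g z))%C with (lf * / g z + f z * ((- / (g z * g z)) * lg))%C by (field; auto).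
apply (has_cderiv_mult f (fun x => / g x)%C). exact Hf.
apply (has_cderiv_comp (fun x => / x)%C g). now apply has_cderiv_inv. exact Hg.
Qed.

Lemma is_derive_Re_line f p q s l :
  has_cderiv f (p + RtoC s * q)%C l ->
  is_derive (fun x : R => Re (f (p + RtoC x * q)%C)) s (Re (l * q)%C).
Proof.
intros H. apply is_derive_Reals. intros eps He.
pose proof (Cmod_ge_0 q).
destruct (H (eps / (2 * (Cmod q + 1))) ltac:(apply Rdiv_lt_0_compat; lra)) as [d [Hd H1]].
assert (Hd' : 0 < d / (Cmod q + 1)) by (apply Rdiv_lt_0_compat; lra).
exists (mkposreal _ Hd'). intros h Hh Hh2. simpl in Hh2.
pose proof (Rabs_pos_lt h Hh) as Hha.
set (y := (p + RtoC (s + h) * q)%C).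
assert (Hy : (y - (p + RtoC s * q))%C = (RtoC h * q)%C) by (unfold y; rewrite RtoC_plus; ring).
specialize (H1 y). rewrite Hy in H1. rewrite Cmod_mult, Cmod_R in H1.
assert (Hlt : Rabs h * Cmod q < d).
{ apply Rle_lt_trans with (Rabs h * (Cmod q + 1)). nra.
  apply Rmult_lt_reg_r with (/ (Cmod q + 1)). apply Rinv_0_lt_compat; lra.
  rewrite Rmult_assoc, Rinv_r by lra. rewrite Rmult_1_r. exact Hh2. }
specialize (H1 Hlt).
replace ((Re (f y) - Re (f (p + RtoC s * q)%C)) / h - Re (l * q)%C) with
  (Re (f y - f (p + RtoC s * q) - l * (RtoC h * q))%C / h).
2:{ replace (l * (RtoC h * q))%C with (RtoC h * (l * q))%C by ring.
  generalize (f y) (f (p + RtoC s * q)%C) (l * q)%C. intros [u1 u2] [v1 v2] [w1 w2]. simpl. field. auto. }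
unfold Rdiv at 1. rewrite Rabs_mult, Rabs_inv.
apply Rmult_lt_reg_r with (Rabs h). auto.
rewrite Rmult_assoc, Rinv_l by lra. rewrite Rmult_1_r.
eapply Rle_lt_trans. apply re_le_Cmod.
eapply Rle_lt_trans. exact H1.
apply Rle_lt_trans with ((eps / 2) * Rabs h * (Cmod q / (Cmod q + 1))).
right. field. lra.
assert (Cmod q / (Cmod q + 1) <= 1). { apply Rmult_le_reg_r with (Cmod q + 1). lra. unfold Rdiv. rewrite Rmult_assoc, Rinv_l; lra. }
assert (0 < eps * Rabs h) by now apply Rmult_lt_0_compat. nra.
Qed.

(** * The complex exponential *)
Lemma Cexp_plus z w : Cexp (z + w)%C = (Cexp z * Cexp w)%C.
Proof.
destruct z as [a b], w as [c d]. unfold Cexp; simpl.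
rewrite exp_plus, cos_plus, sin_plus.
apply injective_projections; simpl; ring.
Qed.

Lemma Cexp_0 : Cexp (RtoC 0) = RtoC 1.
Proof. unfold Cexp; simpl. rewrite exp_0, cos_0, sin_0. apply injective_projections; simpl; ring. Qed.

Lemma Cexp_neq_0 z : Cexp z <> RtoC 0.
Proof.
intros H. assert (Cexp z * Cexp (- z) = 1)%C by (rewrite <- Cexp_plus; replace (z + - z)%C with (RtoC 0) by ring; apply Cexp_0).
rewrite H in H0. apply (f_equal fst) in H0. simpl in H0. lra.
Qed.

Lemma Cmod_le_sum (x : C) : Cmod x <= Rabs (Re x) + Rabs (Im x).
Proof.
apply Rsqr_incr_0_var.
2: pose proof (Rabs_pos (Re x)); pose proof (Rabs_pos (Im x)); lra.
unfold Rsqr. replace (Cmod x * Cmod x) with (Cmod x ^ 2) by ring. rewrite Cmod2_alt.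
rewrite <- (Rabs_pos_eq (Re x ^ 2)), <- (Rabs_pos_eq (Im x ^ 2)) by apply pow2_ge_0.
rewrite <- !RPow_abs. pose proof (Rabs_pos (Re x)); pose proof (Rabs_pos (Im x)). nra.
Qed.

Lemma im_le_Cmod c : Rabs (Im c) <= Cmod c.
Proof. eapply Rle_trans. 2: apply Rmax_Cmod. apply Rmax_r. Qed.

Lemma real_derivative_bound (f : R -> R) (l : R) : derivable_pt_lim f 0 l ->
  forall eps, 0 < eps -> exists d, 0 < d /\ forall h, Rabs h < d -> Rabs (f h - f 0 - l * h) <= eps * Rabs h.
Proof.
intros H eps He. destruct (H eps He) as [d Hd]. exists d. split. apply cond_pos.
intros h Hh. destruct (Req_dec h 0) as [->|Hn].
replace (f 0 - f 0 - l * 0) with 0 by ring. rewrite Rabs_R0. lra.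
specialize (Hd h Hn Hh). rewrite Rplus_0_l in Hd.
replace (f h - f 0 - l * h) with (((f h - f 0) / h - l) * h) by (field; auto).
rewrite Rabs_mult. apply Rmult_le_compat_r. apply Rabs_pos. lra.
Qed.

(** Only the first-order expansions at 0 of the real functions exp, cos and sin enter;
    elsewhere the derivative follows from Cexp (z + w) = Cexp z * Cexp w. *)
Lemma has_cderiv_Cexp_0 : has_cderiv Cexp (RtoC 0) (RtoC 1).
Proof.
intros eps He.
set (e := Rmin 1 (eps / 16)).
assert (He0 : 0 < e) by (apply Rmin_pos; lra).
assert (e <= 1) by apply Rmin_l. assert (e <= eps / 16) by apply Rmin_r.
assert (D1 : derivable_pt_lim exp 0 1) by (rewrite <- exp_0; apply derivable_pt_lim_exp).
assert (D2 : derivable_pt_lim cos 0 0).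
{ generalize (derivable_pt_lim_cos 0). now rewrite sin_0, Ropp_0. }
assert (D3 : derivable_pt_lim sin 0 1) by (rewrite <- cos_0; apply derivable_pt_lim_sin).
destruct (real_derivative_bound _ _ D1 _ He0) as [d1 [Hd1 H1]].
destruct (real_derivative_bound _ _ D2 _ He0) as [d2 [Hd2 H2]].
destruct (real_derivative_bound _ _ D3 _ He0) as [d3 [Hd3 H3]].
exists (Rmin (Rmin d1 d2) (Rmin d3 e)). split. { apply Rmin_pos; apply Rmin_pos; auto. }
intros [x y] Hy.
replace ((x, y) - 0)%C with (x, y) in * by (apply injective_projections; simpl; ring).
pose proof (re_le_Cmod (x, y)) as Bx. pose proof (im_le_Cmod (x, y)) as By. simpl in Bx, By.
set (t := Cmod (x, y)) in *.
assert (t < d1 /\ t < d2 /\ t < d3 /\ t < e) as [A1 [A2 [A3 A4]]].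
{ revert Hy. unfold Rmin; repeat destruct Rle_dec; intros; repeat split; lra. }
specialize (H1 x ltac:(lra)). specialize (H2 y ltac:(lra)). specialize (H3 y ltac:(lra)).
rewrite exp_0 in H1. rewrite cos_0 in H2. rewrite sin_0 in H3.
pose proof (COS_bound y). pose proof (SIN_bound y).
assert (Ac : Rabs (cos y) <= 1) by (apply Rabs_le; lra).
assert (As : Rabs (sin y) <= 1) by (apply Rabs_le; lra).
eapply Rle_trans. apply Cmod_le_sum.
rewrite Cexp_0. unfold Cexp; simpl.
set (X := exp x - 1 - 1 * x) in *. set (Yc := cos y - 1 - 0 * y) in *. set (Ys := sin y - 0 - 1 * y) in *.
match goal with |- Rabs ?u + Rabs ?v <= _ =>
 replace u with (X * cos y + (1 + x) * Yc) by (unfold X, Yc; ring);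
 replace v with (X * sin y + (Ys + x * sin y)) by (unfold X, Ys; ring) end.
assert (Rabs x <= t) by auto. assert (0 <= t) by (apply Cmod_ge_0).
pose proof (Rabs_pos x) as Px. pose proof (Rabs_pos y) as Py.
assert (As2 : Rabs (sin y) <= 2 * t).
{ replace (sin y) with (Ys + y) by (unfold Ys; ring). eapply Rle_trans. apply Rabs_triang. nra. }
assert (Ax : Rabs (1 + x) <= 2).
{ eapply Rle_trans. apply Rabs_triang. rewrite Rabs_R1. lra. }
assert (B1 : Rabs (X * cos y) <= e * t).
{ rewrite Rabs_mult. pose proof (Rabs_pos X). pose proof (Rabs_pos (cos y)). nra. }
assert (B2 : Rabs ((1 + x) * Yc) <= 2 * (e * t)).
{ rewrite Rabs_mult. apply Rmult_le_compat; try apply Rabs_pos; nra. }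
assert (B3 : Rabs (X * sin y) <= e * t).
{ rewrite Rabs_mult. pose proof (Rabs_pos X). pose proof (Rabs_pos (sin y)). nra. }
assert (B4 : Rabs (x * sin y) <= e * (2 * t)).
{ rewrite Rabs_mult. apply Rmult_le_compat; try apply Rabs_pos; nra. }
assert (B5 : Rabs Ys <= e * t) by nra.
pose proof (Rabs_triang (X * cos y) ((1 + x) * Yc)).
pose proof (Rabs_triang (X * sin y) (Ys + x * sin y)).
pose proof (Rabs_triang Ys (x * sin y)).
assert (16 * e * t <= eps * t) by (apply Rmult_le_compat_r; lra).
assert (0 <= e * t) by nra.
lra.
Qed.

Lemma has_cderiv_Cexp z : has_cderiv Cexp z (Cexp z).
Proof.
intros eps He.
assert (Hp : 0 < Cmod (Cexp z)) by apply Cmod_gt_0, Cexp_neq_0.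
destruct (has_cderiv_Cexp_0 (eps / Cmod (Cexp z))) as [d [Hd H]].
now apply Rdiv_lt_0_compat.
exists d. split. auto. intros y Hy.
specialize (H (y - z)%C). replace (y - z - 0)%C with (y - z)%C in H by ring.
specialize (H Hy). rewrite Cexp_0 in H.
replace (Cexp y) with (Cexp z * Cexp (y - z))%C by (rewrite <- Cexp_plus; f_equal; ring).
replace (Cexp z * Cexp (y - z) - Cexp z - Cexp z * (y - z))%C with (Cexp z * (Cexp (y - z) - 1 - 1 * (y - z)))%C by ring.
rewrite Cmod_mult. apply Rmult_le_compat_l with (r := Cmod (Cexp z)) in H. 2: lra.
eapply Rle_trans. exact H. right. field. lra.
Qed.

(** * The unit disk *)
Lemma E_line z s : E z -> 0 <= s <= 1 -> E (RtoC s * z)%C.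
Proof.
unfold E. intros H Hs. rewrite Cmod_mult, Cmod_R, Rabs_pos_eq by lra. pose proof (Cmod_ge_0 z). nra.
Qed.

Lemma E_0 : E (RtoC 0).
Proof. unfold E. rewrite Cmod_0. lra. Qed.

Lemma E_ball z : E z -> exists d, 0 < d /\ forall y, Cmod (y - z)%C < d -> E y.
Proof.
unfold E. intros H. exists (1 - Cmod z). split. lra.
intros y Hy. replace y with ((y - z) + z)%C by ring. pose proof (Cmod_triangle (y - z) z). lra.
Qed.

Lemma has_cderiv_ext_E f g z l : E z ->
  (forall y, E y -> f y = g y) -> has_cderiv f z l -> has_cderiv g z l.
Proof.
intros Hz Hfg. destruct (E_ball z Hz) as [d [Hd H]].
apply has_cderiv_ext_ball with d; auto.
Qed.

(** The mean value theorem on the segment from 0 to z, applied to the real parts of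
    f and of i f. *)
Lemma zero_derivative_E f : (forall z, E z -> has_cderiv f z (RtoC 0)) ->
  forall z, E z -> f z = f (RtoC 0).
Proof.
intros H.
assert (R : forall c z, E z -> Re (c * f z)%C = Re (c * f (RtoC 0))%C).
{ intros c z Hz.
  assert (D : forall s, 0 <= s <= 1 -> is_derive (fun x : R => Re ((fun z => c * f z) (RtoC 0 + RtoC x * z)%C)%C) s 0).
  { intros s Hs.
    assert (P := is_derive_Re_line (fun z => c * f z)%C (RtoC 0) z s (c * 0)%C).
    replace (c * 0 * z)%C with (RtoC 0) in P by ring. apply P.
    apply has_cderiv_scal, H. rewrite Cplus_0_l. now apply E_line. }
  destruct (MVT_gen (fun x : R => Re (c * f (RtoC 0 + RtoC x * z))%C) 0 1 (fun _ => 0)) as [x [_ Hx]].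
  - intros x. rewrite Rmin_left, Rmax_right by lra. intros. apply D. lra.
  - intros x. rewrite Rmin_left, Rmax_right by lra. intros Hx. apply derivable_continuous_pt.
    exists 0. apply is_derive_Reals. now apply D.
  - replace (0 + RtoC 1 * z)%C with z in Hx by ring. replace (0 + 0 * z)%C with (RtoC 0) in Hx by ring. lra. }
intros z Hz. apply injective_projections.
- generalize (R (RtoC 1) z Hz). now rewrite !Cmult_1_l.
- generalize (R Ci z Hz). destruct (f z), (f (RtoC 0)). simpl. lra.
Qed.

(** * Complex series *)

(** Convergence of the real and imaginary parts separately, which is what the
    definition of [CSeries] sums. *)
Definition is_csum (u : nat -> C) (s : C) : Prop :=
  is_series (fun n => Re (u n)) (Re s) /\ is_series (fun n => Im (u n)) (Im s).

Lemma is_csum_CSeries u s : is_csum u s -> CSeries u = s.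
Proof.
intros [H1 H2]. unfold CSeries. rewrite (is_series_unique _ _ H1), (is_series_unique _ _ H2).
now destruct s.
Qed.

Lemma is_csum_unique u s t : is_csum u s -> is_csum u t -> s = t.
Proof. intros H1 H2. now rewrite <- (is_csum_CSeries _ _ H1), <- (is_csum_CSeries _ _ H2). Qed.

Lemma is_csum_ext u v s : (forall n, u n = v n) -> is_csum u s -> is_csum v s.
Proof.
intros E [H1 H2]. split.
eapply is_series_ext. 2: exact H1. intros; simpl; now rewrite E.
eapply is_series_ext. 2: exact H2. intros; simpl; now rewrite E.
Qed.

Lemma is_csum_plus u v s t : is_csum u s -> is_csum v t -> is_csum (fun n => u n + v n)%C (s + t)%C.
Proof.
intros [H1 H2] [H3 H4]. split.
exact (is_series_plus _ _ _ _ H1 H3). exact (is_series_plus _ _ _ _ H2 H4).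
Qed.

Lemma is_csum_scal c u s : is_csum u s -> is_csum (fun n => c * u n)%C (c * s)%C.
Proof.
intros [H1 H2]. destruct c as [a b]. split.
- exact (is_series_minus _ _ _ _ (is_series_scal a _ _ H1) (is_series_scal b _ _ H2)).
- exact (is_series_plus _ _ _ _ (is_series_scal a _ _ H2) (is_series_scal b _ _ H1)).
Qed.

Lemma is_csum_minus u v s t : is_csum u s -> is_csum v t -> is_csum (fun n => u n - v n)%C (s - t)%C.
Proof.
intros Hu Hv. replace (s - t)%C with (s + (- (1)) * t)%C by ring.
eapply is_csum_ext. 2: apply is_csum_plus. 2: exact Hu. 2: apply is_csum_scal, Hv.
intros; simpl; ring.
Qed.

Lemma is_csum_tail u s : is_csum u s -> is_csum (fun n => u (S n)) (s - u O)%C.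
Proof.
intros [H1 H2]. split.
- apply (is_series_incr_1 (fun n => Re (u n))). replace (plus _ _) with (Re s). exact H1.
  unfold plus, Re, Im; simpl. ring.
- apply (is_series_incr_1 (fun n => Im (u n))). replace (plus _ _) with (Im s). exact H2.
  unfold plus, Re, Im; simpl. ring.
Qed.

Lemma is_csum_of_tail u s : is_csum (fun n => u (S n)) (s - u O)%C -> is_csum u s.
Proof.
intros [H1 H2]. split.
- exact (is_series_decr_1 (fun n => Re (u n)) (Re s) H1).
- exact (is_series_decr_1 (fun n => Im (u n)) (Im s) H2).
Qed.

Lemma is_csum_0 : is_csum (fun _ => RtoC 0) (RtoC 0).
Proof.
assert (H : is_series (fun _ : nat => 0) 0).
{ assert (A : Rabs (/ 2) < 1) by (rewrite Rabs_pos_eq; lra).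
  pose proof (is_series_scal (K := R_AbsRing) (V := R_NormedModule) 0 _ _ (is_series_geom (/ 2) A)) as G.
  change (scal 0 (/ (1 - / 2))) with (0 * / (1 - / 2)) in G. rewrite Rmult_0_l in G.
  eapply is_series_ext. 2: exact G. intros n. apply Rmult_0_l. }
split; exact H.
Qed.

(** The factor 2 comes from bounding the two components separately. *)
Lemma is_csum_dominated u b : (forall n, Cmod (u n) <= b n) -> ex_series b ->
  exists s, is_csum u s /\ Cmod s <= 2 * Series b.
Proof.
intros Hb Hs.
assert (A1 : forall n, Rabs (Re (u n)) <= b n) by (intros n; eapply Rle_trans; [apply re_le_Cmod | apply Hb]).
assert (A2 : forall n, Rabs (Im (u n)) <= b n) by (intros n; eapply Rle_trans; [apply im_le_Cmod | apply Hb]).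
assert (E1 : ex_series (fun n => Rabs (Re (u n)))).
{ apply (ex_series_le (V := R_CompleteNormedModule)) with b; auto.
  intros n. unfold norm; simpl. unfold abs; simpl. now rewrite Rabs_Rabsolu. }
assert (E2 : ex_series (fun n => Rabs (Im (u n)))).
{ apply (ex_series_le (V := R_CompleteNormedModule)) with b; auto.
  intros n. unfold norm; simpl. unfold abs; simpl. now rewrite Rabs_Rabsolu. }
exists (Series (fun n => Re (u n)), Series (fun n => Im (u n))).
split. split; apply Series_correct; now apply ex_series_Rabs.
eapply Rle_trans. apply Cmod_le_sum. simpl.
assert (Rabs (Series (fun n => Re (u n))) <= Series b).
{ eapply Rle_trans. apply Series_Rabs, E1. apply Series_le; auto. split. apply Rabs_pos. auto. }
assert (Rabs (Series (fun n => Im (u n))) <= Series b).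
{ eapply Rle_trans. apply Series_Rabs, E2. apply Series_le; auto. split. apply Rabs_pos. auto. }
lra.
Qed.

(** * Power series on the unit disk *)

(** Cauchy-Hadamard condition for radius of convergence at least 1.  Boundedness of
    |a_n| r^n for every r < 1, rather than summability, makes the closure properties
    below immediate: enlarging r slightly absorbs any factor linear in n. *)
Definition disk_coef (a : nat -> C) : Prop :=
  forall r, 0 < r < 1 -> exists M, forall n, Cmod (a n) * r ^ n <= M.

(** The n+1 terms of 1 + s + ... + s^n are all at least s^n. *)
Lemma linear_geom_bound s n : 0 < s < 1 -> INR (S n) * s ^ n <= / (1 - s).
Proof.
intros Hs. apply Rmult_le_reg_r with (1 - s). lra. rewrite Rinv_l by lra.
assert (H : INR (S n) * s ^ n * (1 - s) <= 1 - s ^ (S n)).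
{ induction n. simpl. lra.
  assert (0 < s ^ (S n)) by (apply pow_lt; lra).
  rewrite (S_INR (S n)).
  replace ((INR (S n) + 1) * s ^ S n * (1 - s)) with (s * (INR (S n) * s ^ n * (1 - s)) + s ^ S n * (1 - s)) by (simpl; ring).
  change (s ^ S (S n)) with (s * s ^ S n).
  assert (0 <= INR (S n) * s ^ n * (1 - s)).
  { apply Rmult_le_pos. apply Rmult_le_pos. apply pos_INR. apply pow_le; lra. lra. }
  nra. }
assert (0 < s ^ (S n)) by (apply pow_lt; lra). lra.
Qed.

Lemma between_one r : 0 < r < 1 -> exists q, r < q < 1.
Proof. exists ((r + 1) / 2). lra. Qed.

Lemma pow_split r q n : 0 < q -> r ^ n = q ^ n * (r / q) ^ n.
Proof. intros. rewrite <- Rpow_mult_distr. f_equal. field. lra. Qed.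

Lemma ratio_lt r q : 0 < r < q -> 0 < r / q < 1.
Proof.
intros. split. apply Rdiv_lt_0_compat; lra. apply Rmult_lt_reg_r with q. lra.
unfold Rdiv. rewrite Rmult_assoc, Rinv_l; lra.
Qed.

Lemma disk_coef_linear a b : disk_coef a -> (forall n, Cmod (b n) <= INR (S n) * Cmod (a n)) -> disk_coef b.
Proof.
intros Ha Hb r Hr. destruct (between_one r Hr) as [q Hq].
destruct (Ha q ltac:(lra)) as [M HM]. exists (M * / (1 - r / q)). intros n.
assert (Hs : 0 < r / q < 1) by (apply ratio_lt; lra).
pose proof (linear_geom_bound (r / q) n Hs) as L.
rewrite (pow_split r q n) by lra.
assert (0 < q ^ n) by (apply pow_lt; lra). assert (0 < (r / q) ^ n) by (apply pow_lt; lra).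
apply Rle_trans with ((Cmod (a n) * q ^ n) * (INR (S n) * (r / q) ^ n)).
- replace (Cmod (a n) * q ^ n * (INR (S n) * (r / q) ^ n)) with ((INR (S n) * Cmod (a n)) * (q ^ n * (r / q) ^ n)) by ring.
  apply Rmult_le_compat_r. nra. apply Hb.
- apply Rmult_le_compat; auto.
  + apply Rmult_le_pos. apply Cmod_ge_0. lra.
  + apply Rmult_le_pos. apply pos_INR. lra.
Qed.

Lemma disk_coef_le a b : disk_coef a -> (forall n, Cmod (b n) <= Cmod (a n)) -> disk_coef b.
Proof.
intros Ha Hb. apply (disk_coef_linear a); auto. intros n. eapply Rle_trans. apply Hb.
rewrite S_INR. pose proof (pos_INR n). pose proof (Cmod_ge_0 (a n)). nra.
Qed.

Lemma disk_coef_plus a b : disk_coef a -> disk_coef b -> disk_coef (fun n => a n + b n)%C.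
Proof.
intros Ha Hb r Hr. destruct (Ha r Hr) as [M HM]. destruct (Hb r Hr) as [N HN].
exists (M + N). intros n. specialize (HM n). specialize (HN n).
pose proof (Cmod_triangle (a n) (b n)). assert (0 < r ^ n) by (apply pow_lt; lra). nra.
Qed.

Lemma disk_coef_scal c a : disk_coef a -> disk_coef (fun n => c * a n)%C.
Proof.
intros Ha r Hr. destruct (Ha r Hr) as [M HM]. exists (Cmod c * M). intros n.
rewrite Cmod_mult, Rmult_assoc. apply Rmult_le_compat_l. apply Cmod_ge_0. apply HM.
Qed.

Lemma disk_coef_shift a : disk_coef a -> disk_coef (fun n => a (S n)).
Proof.
intros Ha r Hr. destruct (Ha r Hr) as [M HM]. exists (M / r). intros n.
apply Rmult_le_reg_r with r. lra. unfold Rdiv. rewrite Rmult_assoc, Rmult_assoc, Rinv_l by lra.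
specialize (HM (S n)). simpl in HM. lra.
Qed.

Lemma disk_coef_unshift a : disk_coef (fun n => a (S n)) -> disk_coef a.
Proof.
intros Ha r Hr. destruct (Ha r Hr) as [M HM]. exists (Rmax (Cmod (a O)) M). intros [|n].
simpl. rewrite Rmult_1_r. apply Rmax_l.
eapply Rle_trans. 2: apply Rmax_r. specialize (HM n). simpl.
assert (0 < r ^ n) by (apply pow_lt; lra). pose proof (Cmod_ge_0 (a (S n))).
assert (0 <= Cmod (a (S n)) * r ^ n) by nra.
eapply Rle_trans. 2: exact HM. nra.
Qed.

Lemma disk_coef_abs_summable a r : disk_coef a -> 0 < r < 1 -> ex_series (fun n => Cmod (a n) * r ^ n).
Proof.
intros Ha Hr. destruct (between_one r Hr) as [q Hq].
destruct (Ha q ltac:(lra)) as [M HM].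
assert (Hs : 0 < r / q < 1) by (apply ratio_lt; lra).
apply (ex_series_le (V := R_CompleteNormedModule)) with (fun n => M * (r / q) ^ n).
- intros n. assert (0 < q ^ n) by (apply pow_lt; lra). assert (0 < (r / q) ^ n) by (apply pow_lt; lra).
  unfold norm; simpl; unfold abs; simpl.
  assert (0 < r ^ n) by (apply pow_lt; lra).
  rewrite Rabs_pos_eq by (apply Rmult_le_pos; [apply Cmod_ge_0 | lra]).
  rewrite (pow_split r q n) by lra. rewrite <- Rmult_assoc. apply Rmult_le_compat_r. lra. auto.
- apply (ex_series_scal M (fun n => (r / q) ^ n)). apply ex_series_geom. rewrite Rabs_pos_eq; lra.
Qed.

Definition is_pser (a : nat -> C) (f : C -> C) : Prop :=
  disk_coef a /\ forall z, E z -> is_csum (fun n => a n * z ^ n)%C (f z).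

Lemma E_radius z : E z -> exists r, Cmod z <= r /\ 0 < r < 1.
Proof. unfold E. intros H. exists ((Cmod z + 1) / 2). pose proof (Cmod_ge_0 z). lra. Qed.

Lemma disk_coef_csum a z : disk_coef a -> E z -> exists s, is_csum (fun n => a n * z ^ n)%C s.
Proof.
intros Ha Hz. destruct (E_radius z Hz) as [r [Hr1 Hr]].
destruct (is_csum_dominated (fun n => a n * z ^ n)%C (fun n => Cmod (a n) * r ^ n)) as [s [H _]].
- intros n. rewrite Cmod_mult, Cmod_pow. apply Rmult_le_compat_l. apply Cmod_ge_0.
  apply pow_incr. split. apply Cmod_ge_0. auto.
- now apply disk_coef_abs_summable.
- now exists s.
Qed.

Lemma disk_coef_pser a : disk_coef a -> is_pser a (fun z => CSeries (fun n => a n * z ^ n)%C).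
Proof.
intros Ha. split. auto. intros z Hz. destruct (disk_coef_csum a z Ha Hz) as [s H].
rewrite (is_csum_CSeries _ _ H). exact H.
Qed.

Lemma is_pser_ext a b f g : (forall n, a n = b n) -> (forall z, E z -> f z = g z) -> is_pser a f -> is_pser b g.
Proof.
intros Hab Hfg [H1 H2]. split.
- apply (disk_coef_le a); auto. intros n. rewrite Hab. lra.
- intros z Hz. rewrite <- Hfg by auto. eapply is_csum_ext. 2: apply H2, Hz. intros n; cbv beta; now rewrite Hab.
Qed.

Lemma is_pser_plus a b f g : is_pser a f -> is_pser b g -> is_pser (fun n => a n + b n)%C (fun z => f z + g z)%C.
Proof.
intros [H1 H2] [H3 H4]. split. now apply disk_coef_plus.
intros z Hz. eapply is_csum_ext. 2: apply is_csum_plus; [apply H2, Hz | apply H4, Hz].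
intros; simpl; ring.
Qed.

Lemma is_pser_scal c a f : is_pser a f -> is_pser (fun n => c * a n)%C (fun z => c * f z)%C.
Proof.
intros [H1 H2]. split. now apply disk_coef_scal.
intros z Hz. eapply is_csum_ext. 2: apply is_csum_scal; apply H2, Hz.
intros; simpl; ring.
Qed.

Definition shift_coef (a : nat -> C) (n : nat) : C := match n with O => RtoC 0 | S n => a n end.

Lemma is_pser_mulz a f : is_pser a f -> is_pser (shift_coef a) (fun z => z * f z)%C.
Proof.
intros [H1 H2]. split. apply disk_coef_unshift. exact H1.
intros z Hz. apply is_csum_of_tail. replace (z * f z - shift_coef a 0 * z ^ 0)%C with (z * f z)%C by (simpl; ring).
eapply is_csum_ext. 2: apply is_csum_scal; apply H2, Hz. intros; simpl; ring.
Qed.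

Lemma is_pser_const c : is_pser (fun n => match n with O => c | S _ => RtoC 0 end) (fun _ => c).
Proof.
split.
- intros r Hr. exists (Cmod c). intros [|n]. simpl; lra. rewrite Cmod_0, Rmult_0_l. apply Cmod_ge_0.
- intros z _. apply is_csum_of_tail. replace (c - c * z ^ 0)%C with (RtoC 0) by (simpl; ring).
  eapply is_csum_ext. 2: apply is_csum_0. intros; simpl; ring.
Qed.

(** Coefficients of f(z) / (1 - al z), read off from (1 - al z) b = a. *)
Fixpoint geom_coef (al : C) (a : nat -> C) (n : nat) : C :=
  match n with O => a O | S m => (a (S m) + al * geom_coef al a m)%C end.

(** Each |b_n| is at most |a_0| + ... + |a_n| because |al| <= 1, so passing from a to b
    costs a factor n + 1. *)
Lemma disk_coef_geom al a : Cmod al <= 1 -> disk_coef a -> disk_coef (geom_coef al a).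
Proof.
intros Hal Ha r Hr. destruct (between_one r Hr) as [q Hq].
destruct (Ha q ltac:(lra)) as [M HM].
assert (H : forall n, Cmod (geom_coef al a n) * q ^ n <= INR (S n) * M).
{ induction n.
  - simpl (geom_coef al a 0). specialize (HM O). simpl in *. lra.
  - specialize (HM (S n)). rewrite S_INR.
    assert (Hqn : 0 < q ^ n) by (apply pow_lt; lra).
    apply Rle_trans with (Cmod (a (S n)) * q ^ S n + Cmod (geom_coef al a n) * q ^ n * q).
    + rewrite Rmult_assoc, (Rmult_comm (q ^ n)). change (q * q ^ n) with (q ^ S n).
      rewrite <- Rmult_plus_distr_r. apply Rmult_le_compat_r. apply pow_le; lra.
      simpl (geom_coef al a (S n)).
      eapply Rle_trans. apply Cmod_triangle. apply Rplus_le_compat_l. rewrite Cmod_mult.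
      pose proof (Cmod_ge_0 (geom_coef al a n)). nra.
    + assert (0 <= Cmod (geom_coef al a n) * q ^ n) by (apply Rmult_le_pos; [apply Cmod_ge_0 | lra]). nra. }
exists (M * / (1 - r / q)). intros n.
assert (Hs : 0 < r / q < 1) by (apply ratio_lt; lra).
pose proof (linear_geom_bound (r / q) n Hs) as L.
rewrite (pow_split r q n) by lra. rewrite <- Rmult_assoc.
assert (0 < (r / q) ^ n) by (apply pow_lt; lra).
assert (0 <= M). { eapply Rle_trans. 2: apply (HM O). simpl. pose proof (Cmod_ge_0 (a O)). lra. }
apply Rle_trans with ((INR (S n) * M) * (r / q) ^ n). apply Rmult_le_compat_r. lra. apply H.
replace (INR (S n) * M * (r / q) ^ n) with (M * (INR (S n) * (r / q) ^ n)) by ring.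
apply Rmult_le_compat_l; auto.
Qed.

Lemma linear_factor_neq_0 al z : Cmod al <= 1 -> E z -> (1 - al * z)%C <> RtoC 0.
Proof.
unfold E. intros Hal Hz H.
assert (H1 : (al * z)%C = RtoC 1) by (replace (al * z)%C with (1 - (1 - al * z))%C by ring; rewrite H; ring).
apply (f_equal Cmod) in H1. rewrite Cmod_mult, Cmod_1 in H1.
pose proof (Cmod_ge_0 al). pose proof (Cmod_ge_0 z). nra.
Qed.

Lemma is_pser_div_linear al a f : Cmod al <= 1 -> is_pser a f ->
  is_pser (geom_coef al a) (fun z => f z / (1 - al * z))%C.
Proof.
intros Hal [H1 H2]. pose proof (disk_coef_geom al a Hal H1) as Hb.
split. exact Hb. intros z Hz.
destruct (disk_coef_csum _ z Hb Hz) as [s Hs].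
replace (f z / (1 - al * z))%C with s. exact Hs.
assert (Hf : is_csum (fun n => a n * z ^ n)%C (s - al * z * s)%C).
{ apply is_csum_of_tail. replace (s - al * z * s - a 0%nat * z ^ 0)%C with ((s - geom_coef al a 0 * z ^ 0) - al * z * s)%C by (simpl; ring).
  eapply is_csum_ext. 2: apply is_csum_minus; [apply (is_csum_tail _ _ Hs) | apply (is_csum_scal (al * z) _ _ Hs)].
  intros n; simpl; ring. }
rewrite (is_csum_unique _ _ _ (H2 z Hz) Hf). field. now apply linear_factor_neq_0.
Qed.

(** * Termwise differentiation and Taylor coefficients *)

Definition Cn (n : nat) : C := RtoC (INR n).

Lemma Cn_S n : Cn (S n) = (Cn n + 1)%C.
Proof. unfold Cn. rewrite S_INR, RtoC_plus. reflexivity. Qed.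

Lemma Cmod_Cn n : Cmod (Cn n) = INR n.
Proof. unfold Cn. rewrite Cmod_R, Rabs_pos_eq; auto. apply pos_INR. Qed.

Lemma Cn_neq_0 n : Cn (S n) <> RtoC 0.
Proof. intros H. apply RtoC_inj in H. revert H. apply not_0_INR. lia. Qed.

Definition deriv_coef (a : nat -> C) (n : nat) : C := (Cn (S n) * a (S n))%C.

Lemma disk_coef_deriv a : disk_coef a -> disk_coef (deriv_coef a).
Proof.
intros Ha. apply (disk_coef_linear (fun n => a (S n))). now apply disk_coef_shift.
intros n. unfold deriv_coef. rewrite Cmod_mult, Cmod_Cn. lra.
Qed.

(** Second-order Taylor remainder of z^n.  The factor r^2 on the left replaces
    r^(n-2) on the right, so that n = 0 and n = 1 need no separate treatment. *)
Lemma pow_remainder y z r n : Cmod y <= r -> Cmod z <= r -> 0 < r ->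
  r ^ 2 * Cmod (y ^ n - z ^ n - Cn n * z ^ (pred n) * (y - z))%C <= INR n ^ 2 * r ^ n * Cmod (y - z)%C ^ 2.
Proof.
intros Hy Hz Hr. set (t := Cmod (y - z)%C). assert (Ht : 0 <= t) by apply Cmod_ge_0.
induction n.
- replace (y ^ 0 - z ^ 0 - Cn 0 * z ^ Init.Nat.pred 0 * (y - z))%C with (RtoC 0).
  rewrite Cmod_0. simpl. nra. unfold Cn. simpl. ring.
- replace (y ^ S n - z ^ S n - Cn (S n) * z ^ Init.Nat.pred (S n) * (y - z))%C
   with (y * (y ^ n - z ^ n - Cn n * z ^ (pred n) * (y - z)) + Cn n * z ^ (pred n) * ((y - z) * (y - z)))%C.
  2:{ rewrite Cn_S. destruct n. unfold Cn; simpl; ring. simpl. ring. }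
  eapply Rle_trans. apply Rmult_le_compat_l. apply pow2_ge_0. apply Cmod_triangle.
  rewrite !Cmod_mult, Cmod_Cn, Cmod_pow. fold t.
  set (e := Cmod (y ^ n - z ^ n - Cn n * z ^ Init.Nat.pred n * (y - z))%C) in *.
  assert (B1 : r ^ 2 * (Cmod y * e) <= r * (INR n ^ 2 * r ^ n * t ^ 2)).
  { replace (r ^ 2 * (Cmod y * e)) with (Cmod y * (r ^ 2 * e)) by ring.
    apply Rmult_le_compat; auto. apply Cmod_ge_0. apply Rmult_le_pos. apply pow2_ge_0. apply Cmod_ge_0. }
  assert (B2 : r ^ 2 * (INR n * Cmod z ^ pred n * (t * t)) <= INR n * r ^ S n * t ^ 2).
  { destruct n. simpl. nra. simpl (pred (S n)).
    assert (Cmod z ^ n <= r ^ n) by (apply pow_incr; split; [apply Cmod_ge_0 | auto]).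
    pose proof (pos_INR (S n)). 
    replace (INR (S n) * r ^ S (S n) * t ^ 2) with ((r ^ 2 * INR (S n) * (t * t)) * r ^ n) by (simpl; ring).
    replace (r ^ 2 * (INR (S n) * Cmod z ^ n * (t * t))) with ((r ^ 2 * INR (S n) * (t * t)) * Cmod z ^ n) by ring.
    apply Rmult_le_compat_l; auto. apply Rmult_le_pos; [apply Rmult_le_pos |]; auto. apply pow2_ge_0. nra. }
  rewrite Rmult_plus_distr_l. rewrite S_INR. simpl (r ^ S n) in *.
  pose proof (pos_INR n). assert (0 < r ^ n) by (apply pow_lt; lra). assert (0 <= t ^ 2) by apply pow2_ge_0.
  assert (0 <= r * r ^ n * t ^ 2) by (apply Rmult_le_pos; nra).
  replace ((INR n + 1) ^ 2 * (r * r ^ n) * t ^ 2) with (r * (INR n ^ 2 * r ^ n * t ^ 2) + INR n * (r * r ^ n) * t ^ 2 + (INR n + 1) * (r * r ^ n * t ^ 2)) by ring.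
  assert (0 <= (INR n + 1) * (r * r ^ n * t ^ 2)) by (apply Rmult_le_pos; lra). lra.
Qed.

(** Summing [pow_remainder] against the coefficients bounds the remainder of f by a
    constant times |y - z|^2. *)
Lemma pser_has_cderiv a f : is_pser a f -> forall z, E z ->
  has_cderiv f z (CSeries (fun n => deriv_coef a n * z ^ n)%C).
Proof.
intros [Ha Hf] z Hz.
destruct (disk_coef_pser _ (disk_coef_deriv a Ha)) as [_ Hd]. specialize (Hd z Hz).
set (l := CSeries (fun n => deriv_coef a n * z ^ n)%C) in *.
assert (Hl : is_csum (fun n => a n * (Cn n * z ^ pred n))%C l).
{ apply is_csum_of_tail. simpl. replace (l - a 0%nat * (Cn 0 * 1))%C with l by (unfold Cn; simpl; ring).
  eapply is_csum_ext. 2: exact Hd. intros; unfold deriv_coef; simpl. ring. }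
clearbody l. clear Hd.
set (r := (1 + Cmod z) / 2). pose proof (Cmod_ge_0 z). unfold E in Hz.
assert (Hr : 0 < r < 1) by (unfold r; lra).
set (b := fun n => INR n ^ 2 * (Cmod (a n) * r ^ n) / r ^ 2).
assert (Hb : ex_series b).
{ apply (ex_series_ext (fun n => / r ^ 2 * (Cmod (Cn n * (Cn n * a n))%C * r ^ n))).
  - intros n. unfold b. rewrite !Cmod_mult, Cmod_Cn. simpl. field. lra.
  - apply (ex_series_scal (/ r ^ 2) (fun n => Cmod (Cn n * (Cn n * a n))%C * r ^ n)).
    apply disk_coef_abs_summable; auto.
    apply (disk_coef_linear (fun n => Cn n * a n)%C). apply (disk_coef_linear a); auto.
    + intros n. rewrite Cmod_mult, Cmod_Cn, S_INR. pose proof (Cmod_ge_0 (a n)). lra.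
    + intros n. rewrite (Cmod_mult (Cn n) (Cn n * a n)), Cmod_Cn, S_INR. pose proof (Cmod_ge_0 (Cn n * a n)%C). lra. }
set (K := 2 * Series b + 1).
assert (Hrem : forall y, Cmod (y - z)%C < (1 - Cmod z) / 2 -> Cmod (f y - f z - l * (y - z))%C <= K * Cmod (y - z)%C ^ 2).
{ intros y Hy. assert (Cmod y < r).
  { unfold r. replace y with ((y - z) + z)%C by ring. pose proof (Cmod_triangle (y - z) z). lra. }
  set (t := Cmod (y - z)%C) in *.
  destruct (is_csum_dominated (fun n => a n * y ^ n - a n * z ^ n - (y - z) * (a n * (Cn n * z ^ pred n)))%C (fun n => t ^ 2 * b n)) as [s [Hs Hs2]].
  - intros n.
    replace (a n * y ^ n - a n * z ^ n - (y - z) * (a n * (Cn n * z ^ pred n)))%C with (a n * (y ^ n - z ^ n - Cn n * z ^ pred n * (y - z)))%C by ring.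
    rewrite Cmod_mult. pose proof (pow_remainder y z r n ltac:(lra) ltac:(unfold r; lra) ltac:(lra)) as P. fold t in P.
    unfold b. apply Rmult_le_reg_l with (r ^ 2). nra.
    replace (r ^ 2 * (t ^ 2 * (INR n ^ 2 * (Cmod (a n) * r ^ n) / r ^ 2))) with (Cmod (a n) * (INR n ^ 2 * r ^ n * t ^ 2)) by (field; lra).
    replace (r ^ 2 * (Cmod (a n) * Cmod (y ^ n - z ^ n - Cn n * z ^ Init.Nat.pred n * (y - z)))) with (Cmod (a n) * (r ^ 2 * Cmod (y ^ n - z ^ n - Cn n * z ^ Init.Nat.pred n * (y - z)))) by ring.
    apply Rmult_le_compat_l. apply Cmod_ge_0. exact P.
  - now apply (ex_series_scal (t ^ 2) b).
  - rewrite Series_scal_l in Hs2.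
    replace (f y - f z - l * (y - z))%C with s.
    unfold K. assert (0 <= t ^ 2) by apply pow2_ge_0. nra.
    apply (is_csum_unique _ _ _ Hs).
    replace (l * (y - z))%C with ((y - z) * l)%C by ring.
    apply is_csum_minus. apply is_csum_minus; apply Hf; unfold E; lra. now apply is_csum_scal. }
intros eps He.
assert (HK : 0 < K).
{ unfold K. assert (0 <= Series b); [|lra].
  rewrite <- (Rmult_0_l (Series b)), <- Series_scal_l. apply Series_le; auto. intros n. split. lra.
  rewrite Rmult_0_l. unfold b. apply Rmult_le_pos. apply Rmult_le_pos. apply pow2_ge_0.
  apply Rmult_le_pos. apply Cmod_ge_0. apply pow_le; lra. left. apply Rinv_0_lt_compat. nra. }
exists (Rmin ((1 - Cmod z) / 2) (eps / K)). split.
apply Rmin_pos. lra. now apply Rdiv_lt_0_compat.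
intros y Hy.
assert (H1 : Cmod (y - z)%C < (1 - Cmod z) / 2) by (apply Rlt_le_trans with (1 := Hy), Rmin_l).
assert (H2 : Cmod (y - z)%C < eps / K) by (apply Rlt_le_trans with (1 := Hy), Rmin_r).
eapply Rle_trans. apply Hrem, H1. pose proof (Cmod_ge_0 (y - z)%C).
replace (K * Cmod (y - z)%C ^ 2) with ((K * Cmod (y - z)%C) * Cmod (y - z)%C) by ring.
apply Rmult_le_compat_r; auto.
apply Rmult_lt_compat_l with (r := K) in H2; auto. replace (K * (eps / K)) with eps in H2 by (field; lra). lra.
Qed.

Lemma is_pser_derive a f : is_pser a f -> is_pser (deriv_coef a) (C_derive f).
Proof.
intros H. eapply is_pser_ext. 3: apply disk_coef_pser, disk_coef_deriv, (proj1 H). auto.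
intros z Hz. simpl. symmetry. apply has_cderiv_C_derive. now apply (pser_has_cderiv a).
Qed.

Lemma pser_has_C_derive a f z : is_pser a f -> E z -> has_cderiv f z (C_derive f z).
Proof.
intros H Hz. pose proof (pser_has_cderiv a f H z Hz) as D. now rewrite (has_cderiv_C_derive _ _ _ D).
Qed.

Lemma pser_at_0 a f : is_pser a f -> f (RtoC 0) = a O.
Proof.
intros [_ H]. apply (is_csum_unique _ _ _ (H _ E_0)). apply is_csum_of_tail.
replace (a 0%nat - a 0%nat * 0 ^ 0)%C with (RtoC 0) by (simpl; ring).
eapply is_csum_ext. 2: apply is_csum_0. intros; simpl; ring.
Qed.

Lemma is_pser_iter_derive a f n : is_pser a f -> is_pser (Nat.iter n deriv_coef a) (Nat.iter n C_derive f).
Proof. intros H. induction n. exact H. simpl. now apply is_pser_derive. Qed.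

(** The factorials of k are cleared to avoid division; the case k = 0 is what
    [taylor] reads. *)
Lemma iter_deriv_coef a n k :
  (RtoC (INR (fact k)) * Nat.iter n deriv_coef a k)%C = (RtoC (INR (fact (n + k))) * a (n + k)%nat)%C.
Proof.
revert k. induction n; intros k. reflexivity.
simpl Nat.iter. unfold deriv_coef at 1.
replace (S n + k)%nat with (n + S k)%nat by lia. rewrite <- IHn.
change (fact (S k)) with (S k * fact k)%nat. rewrite mult_INR, RtoC_mult. unfold Cn. ring.
Qed.

Lemma taylor_pser a f n : is_pser a f -> taylor f n = a n.
Proof.
intros H. unfold taylor. rewrite (pser_at_0 _ _ (is_pser_iter_derive a f n H)).
pose proof (iter_deriv_coef a n 0) as I. rewrite Nat.add_0_r in I. simpl (fact 0) in I. simpl (INR 1) in I.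
rewrite Cmult_1_l in I. rewrite I. field. intros Z. apply RtoC_inj in Z. revert Z. apply INR_fact_neq_0.
Qed.

(** The termwise antiderivative has the same derivative and the same value at 0 as f.
    It yields power series for h and g from the explicit ones for h' and g'. *)
Lemma is_pser_antiderivative a f f1 : is_pser a f1 -> f (RtoC 0) = RtoC 0 ->
  (forall z, E z -> has_cderiv f z (f1 z)) -> exists b, is_pser b f.
Proof.
intros Ha Hf0 Hf.
set (b := fun n => match n with O => RtoC 0 | S n => (a n / Cn (S n))%C end).
assert (Hb : disk_coef b).
{ apply disk_coef_unshift. simpl. apply (disk_coef_le a). apply Ha. intros n.
  rewrite Cmod_div, Cmod_Cn by apply Cn_neq_0. rewrite S_INR.
  pose proof (pos_INR n). pose proof (Cmod_ge_0 (a n)).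
  apply Rmult_le_reg_r with (INR n + 1). lra. unfold Rdiv. rewrite Rmult_assoc, Rinv_l by lra. nra. }
exists b. pose proof (disk_coef_pser b Hb) as Hs. set (g := fun z => CSeries (fun n => b n * z ^ n)%C) in *.
assert (Hg0 : g (RtoC 0) = RtoC 0) by apply (pser_at_0 _ _ Hs).
eapply is_pser_ext. 3: exact Hs. auto. intros z Hz.
assert (Hd : (g z - f z)%C = (g (RtoC 0) - f (RtoC 0))%C).
{ apply (zero_derivative_E (fun z => g z - f z)%C); auto. intros w Hw.
  replace (RtoC 0) with (C_derive g w - f1 w)%C. apply has_cderiv_minus; auto. now apply (pser_has_C_derive b).
  replace (C_derive g w) with (f1 w). ring.
  apply (is_csum_unique (fun n => a n * w ^ n)%C). now apply Ha.
  eapply is_csum_ext. 2: apply (is_pser_derive _ _ Hs); auto.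
  intros n. unfold deriv_coef; simpl. field. apply Cn_neq_0. }
rewrite Hg0, Hf0 in Hd. replace (g z) with ((g z - f z) + f z)%C by ring. rewrite Hd. ring.
Qed.

(** * The Hadamard product with a half-plane mapping *)

(** The factor n in the coefficients acts as z d/dz, the constant as the identity. *)
Lemma hadamard_affine F f a lam mu z : (forall n, taylor F (S n) = (lam * Cn (S n) + mu)%C) ->
  is_pser a f -> f (RtoC 0) = RtoC 0 -> E z ->
  hadamard F f z = (lam * (z * C_derive f z) + mu * f z)%C.
Proof.
intros HF Hf Hf0 Hz. unfold hadamard. apply is_csum_CSeries.
eapply is_csum_ext.
2:{ apply is_csum_plus; apply is_csum_scal.
    - apply is_csum_scal. apply (is_pser_derive _ _ Hf); auto.
    - replace (f z) with (f z - a O * z ^ 0)%C. apply (is_csum_tail (fun n => a n * z ^ n)%C). now apply Hf.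
      rewrite <- (pser_at_0 _ _ Hf), Hf0. simpl. ring. }
intros n. simpl. rewrite HF, (taylor_pser _ _ _ Hf). unfold deriv_coef. ring.
Qed.

(** From z/(1-z)^2 = sum n z^n and z^2/(1-z)^2 = sum (n-1) z^n. *)
Lemma taylor_half_plane c n :
  taylor (fun z => (c * z - RtoC (1 / 2) * z ^ 2) / (RtoC 1 - z) ^ 2)%C (S n) = ((c - RtoC (1 / 2)) * Cn (S n) + RtoC (1 / 2))%C.
Proof.
assert (H1 : Cmod (RtoC 1) <= 1) by (rewrite Cmod_1; lra).
pose proof (is_pser_div_linear 1 _ _ H1 (is_pser_div_linear 1 _ _ H1 (is_pser_const (RtoC 1)))) as K.
pose proof (is_pser_mulz _ _ K) as K1. pose proof (is_pser_mulz _ _ K1) as K2.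
pose proof (is_pser_plus _ _ _ _ (is_pser_scal c _ _ K1) (is_pser_scal (- RtoC (1 / 2))%C _ _ K2)) as K3.
set (u := fun n : nat => match n with O => RtoC 1 | S _ => RtoC 0 end) in *.
assert (U1 : forall n, geom_coef 1 u n = RtoC 1).
{ induction n0; simpl. reflexivity. rewrite IHn0. ring. }
assert (U2 : forall n, geom_coef 1 (geom_coef 1 u) n = Cn (S n)).
{ induction n0. unfold Cn. simpl. reflexivity.
  change (geom_coef 1 (geom_coef 1 u) (S n0)) with (geom_coef 1 u (S n0) + 1 * geom_coef 1 (geom_coef 1 u) n0)%C.
  rewrite U1, IHn0, (Cn_S (S n0)). ring. }
erewrite taylor_pser. 2:{ eapply is_pser_ext. 3: exact K3. reflexivity.
  intros z Hz. simpl. field. pose proof (linear_factor_neq_0 _ z H1 Hz) as N. rewrite Cmult_1_l in N. exact N. }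
destruct n.
- simpl. unfold Cn. simpl. ring.
- change (shift_coef (shift_coef (geom_coef 1 (geom_coef 1 u))) (S (S n))) with (geom_coef 1 (geom_coef 1 u) n).
  change (shift_coef (geom_coef 1 (geom_coef 1 u)) (S (S n))) with (geom_coef 1 (geom_coef 1 u) (S n)).
  rewrite !U2, (Cn_S (S n)). ring.
Qed.

(** * Real-variable lemmas on intervals and curves *)

(** Induction along a real interval; it serves both for monotonicity from local
    information and for connectedness. *)
Lemma real_induction (P : R -> Prop) a b : a <= b ->
  P a ->
  (forall s, a <= s < b -> P s -> exists d, 0 < d /\ forall s', s < s' < s + d -> P s') ->
  (forall s, a < s <= b -> (forall s', a <= s' < s -> P s') -> P s) ->
  P b.
Proof.
intros Hab Pa Hr Hl.
set (Q := fun s => a <= s <= b /\ forall s', a <= s' <= s -> P s').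
destruct (completeness Q) as [m [M1 M2]].
- exists b. intros x [Hx _]. lra.
- exists a. split. lra. intros s' Hs'. now replace s' with a by lra.
- assert (Qa : Q a). { split. lra. intros s' Hs'. now replace s' with a by lra. }
  assert (Ham : a <= m) by now apply M1.
  assert (Hmb : m <= b). { apply M2. intros x [Hx _]. lra. }
  assert (Hlt : forall s', a <= s' < m -> P s').
  { intros s' Hs'. apply NNPP. intros N. assert (m <= s'); [|lra]. apply M2. intros x [Hx1 Hx2].
    apply Rnot_lt_le. intros Hlt. apply N, Hx2. lra. }
  assert (Pm : P m). { destruct (Req_dec a m) as [<-|]. auto. apply Hl; auto. lra. }
  destruct (Req_dec m b) as [<-|]. auto.
  destruct (Hr m ltac:(lra) Pm) as [d [Hd H1]].
  assert (Rmin b (m + d / 2) <= m).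
  { apply M1. split. unfold Rmin; destruct Rle_dec; lra.
    intros s' Hs'. destruct (Rlt_dec s' m). apply Hlt; lra. destruct (Req_dec s' m) as [->|]. auto.
    apply H1. revert Hs'. unfold Rmin; destruct Rle_dec; lra. }
  revert H0. unfold Rmin; destruct Rle_dec; lra.
Qed.

Lemma locally_increasing (k : R -> R) a b : a < b ->
  (forall s, a <= s <= b -> exists d, 0 < d /\ forall s', a <= s' <= b -> Rabs (s' - s) < d -> s' <> s -> 0 < (s' - s) * (k s' - k s)) ->
  k a < k b.
Proof.
intros Hab H.
assert (P : b = a \/ k a < k b).
{ apply (real_induction (fun s => s = a \/ k a < k s) a b); auto. lra.
  - intros s Hs Ps. destruct (H s ltac:(lra)) as [d [Hd H1]].
    exists (Rmin d (b - s)). split. apply Rmin_pos; lra.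
    intros s' Hs'.
    assert (s' < s + d /\ s' < b) as [A1 A2] by (revert Hs'; unfold Rmin; destruct Rle_dec; lra).
    right. specialize (H1 s' ltac:(lra) ltac:(rewrite Rabs_pos_eq; lra) ltac:(lra)).
    destruct Ps as [->|]; nra.
  - intros s Hs Hl. right. destruct (H s ltac:(lra)) as [d [Hd H1]].
    set (s' := Rmax a (s - d / 2)).
    assert (A : a <= s' < s /\ s - d < s') by (unfold s', Rmax; destruct Rle_dec; lra).
    specialize (H1 s' ltac:(lra) ltac:(rewrite Rabs_left; lra) ltac:(lra)).
    destruct (Hl s' ltac:(lra)) as [->|]; nra. }
destruct P; lra.
Qed.

Lemma connected_set_ext (U V : C -> Prop) : (forall p, U p <-> V p) -> connected_set U -> connected_set V.
Proof.
intros Heq HU A B HA HB Hcov [p [P1 P2]] [q [Q1 Q2]].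
destruct (HU A B HA HB) as [r [R1 R2]].
- intros z Hz. apply Hcov. now apply Heq.
- exists p. split; auto. now apply Heq.
- exists q. split; auto. now apply Heq.
- exists r. split; auto. now apply Heq.
Qed.

Lemma connected_curve (gam : R -> C) l u :
  (forall t, l < t < u -> forall eps, 0 < eps -> exists d, 0 < d /\ forall t', l < t' < u -> Rabs (t' - t) < d -> Cmod (gam t' - gam t)%C < eps) ->
  connected_set (fun p => exists t, l < t < u /\ p = gam t).
Proof.
intros Hc.
assert (Op : forall W : C -> Prop, open (T := C_UniformSpace) W -> forall t, l < t < u -> W (gam t) ->
  exists d, 0 < d /\ forall t', l < t' < u -> Rabs (t' - t) < d -> W (gam t')).
{ intros W HW t Ht Wt. destruct (HW _ Wt) as [e He].
  destruct (Hc t Ht e (cond_pos e)) as [d [Hd H1]]. exists d. split; auto.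
  intros t' Ht' Hd'. apply He. specialize (H1 t' Ht' Hd').
  split; (eapply Rle_lt_trans; [|exact H1]).
  apply (re_le_Cmod (gam t' - gam t)%C). apply (im_le_Cmod (gam t' - gam t)%C). }
assert (W : forall U V : C -> Prop,
  open (T := C_UniformSpace) U -> open (T := C_UniformSpace) V ->
  (forall t, l < t < u -> U (gam t) \/ V (gam t)) ->
  forall t1 t2, l < t1 < u -> l < t2 < u -> t1 <= t2 -> U (gam t1) -> V (gam t2) ->
  exists t, l < t < u /\ U (gam t) /\ V (gam t)).
{ intros U V HU HV Hcov t1 t2 Ht1 Ht2 Hle U1 V2. apply NNPP. intros N.
  apply N. exists t2. repeat split; try lra; auto.
  apply (real_induction (fun t => U (gam t)) t1 t2); auto.
  - intros s Hs Us. destruct (Op U HU s ltac:(lra) Us) as [d [Hd H1]].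
    exists (Rmin d (t2 - s)). split. apply Rmin_pos; lra.
    intros s' Hs'. assert (s' < s + d /\ s' < t2) by (revert Hs'; unfold Rmin; destruct Rle_dec; lra).
    apply H1. lra. rewrite Rabs_pos_eq; lra.
  - intros s Hs Hl. destruct (Hcov s ltac:(lra)) as [|Vs]. auto. exfalso. apply N.
    destruct (Op V HV s ltac:(lra) Vs) as [d [Hd H1]].
    set (s' := Rmax t1 (s - d / 2)).
    assert (A : t1 <= s' < s /\ s - d < s') by (unfold s', Rmax; destruct Rle_dec; lra).
    exists s'. repeat split; try lra. apply Hl; lra. apply H1. lra. rewrite Rabs_left; lra. }
intros U V HU HV Hcov [p [[t1 [Ht1 ->]] U1]] [q [[t2 [Ht2 ->]] V2]].
assert (Hcov' : forall t, l < t < u -> U (gam t) \/ V (gam t)) by (intros t Ht; apply Hcov; eauto).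
destruct (Rle_dec t1 t2).
- destruct (W U V HU HV Hcov' t1 t2) as [t [Ht [A1 A2]]]; auto. exists (gam t). eauto.
- destruct (W V U HV HU) with (t1 := t2) (t2 := t1) as [t [Ht [A1 A2]]]; auto; try lra.
  intros t Ht. destruct (Hcov' t Ht); auto. exists (gam t). eauto.
Qed.

(** Replaces differentiating along the level curve of Im A.  For z near z0 on that
    curve A(z) - A(z0) is a real number r with z - z0 = r/a + o(r), so
    B(z) - B(z0) = r b/a + o(r), whose real part has the sign of r. *)
Lemma local_sign A B z0 a b : has_cderiv A z0 a -> has_cderiv B z0 b -> a <> RtoC 0 -> 0 < Re (b / a)%C ->
  exists d, 0 < d /\ forall z, Cmod (z - z0)%C < d -> Im (A z) = Im (A z0) -> z <> z0 ->
    0 < (Re (A z) - Re (A z0)) * (Re (B z) - Re (B z0)).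
Proof.
intros HA HB Ha Hk. set (k := Re (b / a)%C) in *. set (q := Cmod (b / a)%C).
assert (Hq : 0 <= q) by apply Cmod_ge_0.
pose proof (proj1 (Cmod_gt_0 a) Ha) as Hm. set (m := Cmod a) in *.
(* eta <= m/2 gives |z - z0| <= 2|r|/m; the other bound keeps the error below k|r|/2 *)
set (eta := Rmin (m / 2) (k * m / (4 * (q + 1)))).
assert (0 < k * m) by now apply Rmult_lt_0_compat.
assert (0 < k * m / (4 * (q + 1))) by (apply Rdiv_lt_0_compat; lra).
assert (He0 : 0 < eta) by (apply Rmin_pos; lra).
assert (He1 : eta <= m / 2) by apply Rmin_l.
assert (He2 : 4 * ((q + 1) * eta) <= k * m).
{ apply Rle_trans with (4 * ((q + 1) * (k * m / (4 * (q + 1))))).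
  repeat apply Rmult_le_compat_l; try lra. apply Rmin_r. right; field; lra. }
destruct (HA eta He0) as [d1 [Hd1 H1]]. destruct (HB eta He0) as [d2 [Hd2 H2]].
exists (Rmin d1 d2). split. now apply Rmin_pos.
intros z Hz Him Hne.
specialize (H1 z (Rlt_le_trans _ _ _ Hz (Rmin_l _ _))). specialize (H2 z (Rlt_le_trans _ _ _ Hz (Rmin_r _ _))).
set (e1 := (A z - A z0 - a * (z - z0))%C) in *. set (e2 := (B z - B z0 - b * (z - z0))%C) in *.
set (t := Cmod (z - z0)%C) in *.
assert (Ht : 0 < t). { apply Cmod_gt_0. intros Z. apply Hne. replace z with ((z - z0) + z0)%C by ring. rewrite Z. ring. }
set (r := Re (A z) - Re (A z0)).
assert (Hr : (A z - A z0)%C = RtoC r).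
{ apply injective_projections. reflexivity. unfold Im in Him. simpl. lra. }
assert (Htr : m * t <= Rabs r + eta * t).
{ unfold m, t. rewrite <- Cmod_mult. replace (a * (z - z0))%C with ((A z - A z0) + - e1)%C by (unfold e1; ring).
  eapply Rle_trans. apply Cmod_triangle. rewrite Cmod_opp, Hr, Cmod_R. fold t. lra. }
assert (Het : eta * t <= m / 2 * t) by (apply Rmult_le_compat_r; lra).
assert (Hmt : m * t <= 2 * Rabs r) by lra.
assert (HBd : (B z - B z0)%C = (b / a * RtoC r + (e2 - b / a * e1))%C).
{ rewrite <- Hr. unfold e1, e2. field. auto. }
assert (HRe : Re (B z) - Re (B z0) = k * r + Re (e2 - b / a * e1)%C).
{ transitivity (Re (B z - B z0)%C). reflexivity. rewrite HBd. unfold k. unfold Re. simpl. ring. }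
assert (Herr : Rabs (Re (e2 - b / a * e1)%C) <= (q + 1) * eta * t).
{ eapply Rle_trans. apply re_le_Cmod. unfold Cminus. eapply Rle_trans. apply Cmod_triangle.
  rewrite Cmod_opp, Cmod_mult. fold q.
  apply Rmult_le_compat_l with (r := q) in H1; auto. lra. }
rewrite HRe. set (er := Re (e2 - b / a * e1)%C) in *.
assert (Hra : 0 < Rabs r) by nra.
assert (Her : m * Rabs er <= m * (k / 2 * Rabs r)).
{ apply Rle_trans with ((q + 1) * eta * (m * t)). nra.
  apply Rle_trans with ((q + 1) * eta * (2 * Rabs r)). apply Rmult_le_compat_l; nra. nra. }
apply Rmult_le_reg_l in Her; auto.
pose proof (Rle_abs er). pose proof (Rle_abs (- er)). rewrite Rabs_Ropp in *.
destruct (Rtotal_order r 0) as [Hr0|[Hr0|Hr0]].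
- rewrite (Rabs_left r) in * by auto. assert (k * r < 0) by nra. assert (k * r + er < 0) by lra. nra.
- rewrite Hr0, Rabs_R0 in Hra. lra.
- rewrite (Rabs_pos_eq r) in * by lra. apply Rmult_lt_0_compat; auto. assert (0 < k * r) by nra. lra.
Qed.

(** * Shearing on a horizontal strip *)

Definition strip (w : C) : Prop := - (PI / 2) < Im w < PI / 2.

Section Strip.
Variables A B a b : C -> C.
Hypothesis HA : forall w, strip w -> has_cderiv A w (a w).
Hypothesis HB : forall w, strip w -> has_cderiv B w (b w).
Hypothesis Ha : forall w, strip w -> 0 < Re (a w).
Hypothesis Hb : forall w, strip w -> 0 < Re (Ci * b w / a w)%C.
Hypothesis Hrange : forall t c, - (PI / 2) < t < PI / 2 ->
  (exists x, Re (A (x, t)) < c) /\ (exists x, c < Re (A (x, t))).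

Lemma strip_line_derive (F f : C -> C) t x : has_cderiv F (x, t) (f (x, t)) ->
  is_derive (fun x : R => Re (F (x, t))) x (Re (f (x, t))).
Proof.
intros HF.
assert (P : forall y : R, ((0, t) + RtoC y * 1)%C = (y, t)) by (intros; apply injective_projections; simpl; ring).
pose proof (is_derive_Re_line F (0, t) (RtoC 1) x (f (x, t))) as D. rewrite P, Cmult_1_r in D.
eapply is_derive_ext. 2: exact (D HF). intros y. simpl. now rewrite P.
Qed.

Lemma strip_line_increasing (F f : C -> C) t : (forall x, has_cderiv F (x, t) (f (x, t))) ->
  (forall x, 0 < Re (f (x, t))) -> forall x y, x < y -> Re (F (x, t)) < Re (F (y, t)).
Proof.
intros HF Hf x y Hxy.
apply (incr_function (fun x => Re (F (x, t))) m_infty p_infty (fun x => Re (f (x, t)))); try exact I; auto.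
intros. now apply strip_line_derive. intros; apply Hf.
Qed.

Lemma shear_derivative_neq_0 w : strip w -> a w <> RtoC 0.
Proof. intros Hw Z. specialize (Ha w Hw). rewrite Z in Ha. simpl in Ha. lra. Qed.

Lemma level_point t c : - (PI / 2) < t < PI / 2 -> exists x, Re (A (x, t)) = c.
Proof.
intros Ht. destruct (Hrange t c Ht) as [[x1 H1] [x2 H2]].
destruct (IVT_gen (fun x => Re (A (x, t))) x1 x2 c) as [x [_ Hx]].
- intros x. apply derivable_continuous_pt. exists (Re (a (x, t))). apply is_derive_Reals.
  now apply strip_line_derive, HA.
- split. eapply Rle_trans. apply Rmin_l. lra. eapply Rle_trans. 2: apply Rmax_r. lra.
- eauto.
Qed.

Lemma level_unique t x y : - (PI / 2) < t < PI / 2 -> Re (A (x, t)) = Re (A (y, t)) -> x = y.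
Proof.
intros Ht E.
assert (M : forall x y, x < y -> Re (A (x, t)) < Re (A (y, t))) by (apply (strip_line_increasing A a); auto).
destruct (Rtotal_order x y) as [H|[H|H]]; auto; apply M in H; lra.
Qed.

Lemma vertical_continuity F f x t : has_cderiv F (x, t) f ->
  forall eps, 0 < eps -> exists d, 0 < d /\ forall t', Rabs (t' - t) < d -> Rabs (Re (F (x, t')) - Re (F (x, t))) < eps.
Proof.
intros HF eps He. destruct (has_cderiv_lipschitz _ _ _ HF) as [M [d [HM [Hd H]]]].
exists (Rmin d (eps / M)). split. apply Rmin_pos; auto. now apply Rdiv_lt_0_compat.
intros t' Ht'.
assert (Hc : Cmod ((x, t') - (x, t))%C = Rabs (t' - t)).
{ replace ((x, t') - (x, t))%C with (Ci * RtoC (t' - t))%C by (apply injective_projections; simpl; ring).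
  rewrite Cmod_mult, Cmod_Ci, Cmod_R. ring. }
specialize (H (x, t')). rewrite Hc in H.
specialize (H (Rlt_le_trans _ _ _ Ht' (Rmin_l _ _))).
pose proof (Rlt_le_trans _ _ _ Ht' (Rmin_r _ _)) as H2.
apply Rle_lt_trans with (Cmod (F (x, t') - F (x, t))%C). apply (re_le_Cmod (F (x, t') - F (x, t))%C).
eapply Rle_lt_trans. exact H. apply Rmult_lt_compat_l with (r := M) in H2; auto.
replace (M * (eps / M)) with eps in H2 by (field; lra). exact H2.
Qed.

Section Level.
Variable c : R.
Variable xi : R -> R.
Hypothesis Hxi : forall t, - (PI / 2) < t < PI / 2 -> Re (A (xi t, t)) = c.

Let gam (t : R) : C := (xi t, t).

(** Squeezing: c lies strictly between the values of Re A at the two points at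
    horizontal distance eps/2 from the curve, and this persists for nearby t. *)
Lemma level_continuous t : - (PI / 2) < t < PI / 2 -> forall eps, 0 < eps ->
  exists d, 0 < d /\ forall t', - (PI / 2) < t' < PI / 2 -> Rabs (t' - t) < d -> Cmod (gam t' - gam t)%C < eps.
Proof.
intros Ht eps He.
assert (M : forall t, - (PI / 2) < t < PI / 2 -> forall x y, x < y -> Re (A (x, t)) < Re (A (y, t))).
{ intros s Hs. apply (strip_line_increasing A a); auto. }
set (x1 := xi t - eps / 2). set (x2 := xi t + eps / 2).
assert (M1 : Re (A (x1, t)) < c). { rewrite <- (Hxi t Ht). apply M; auto. unfold x1; lra. }
assert (M2 : c < Re (A (x2, t))). { rewrite <- (Hxi t Ht). apply M; auto. unfold x2; lra. }
destruct (vertical_continuity A _ x1 t (HA (x1, t) Ht) (c - Re (A (x1, t))) ltac:(lra)) as [d1 [Hd1 C1]].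
destruct (vertical_continuity A _ x2 t (HA (x2, t) Ht) (Re (A (x2, t)) - c) ltac:(lra)) as [d2 [Hd2 C2]].
exists (Rmin (eps / 2) (Rmin d1 d2)). split. repeat apply Rmin_pos; lra.
intros t' Ht' Hd.
assert (Rabs (t' - t) < eps / 2 /\ Rabs (t' - t) < d1 /\ Rabs (t' - t) < d2) as [B0 [B1 B2]].
{ revert Hd. unfold Rmin; repeat destruct Rle_dec; lra. }
specialize (C1 t' B1). specialize (C2 t' B2). apply Rabs_def2 in C1. apply Rabs_def2 in C2.
assert (x1 < xi t').
{ apply Rnot_le_lt. intros [Hl|He']. apply (M t' Ht') in Hl. rewrite (Hxi t' Ht') in Hl. lra.
  pose proof (Hxi t' Ht') as Q. rewrite He' in Q. lra. }
assert (xi t' < x2).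
{ apply Rnot_le_lt. intros [Hl|He']. apply (M t' Ht') in Hl. rewrite (Hxi t' Ht') in Hl. lra.
  pose proof (Hxi t' Ht') as Q. rewrite <- He' in Q. lra. }
eapply Rle_lt_trans. apply Cmod_le_sum. unfold gam; simpl. unfold x1, x2 in *.
assert (Rabs (xi t' + - xi t) < eps / 2) by (apply Rabs_def1; lra).
unfold Rminus in B0. lra.
Qed.

(** On the level curve - i A has real increments r.  By [local_sign], applied to the
    pairs (- i A, - i w) and (- i A, B), both Im w and Re B move locally in the
    direction of r, hence in the same direction as each other. *)
Lemma level_increasing t1 t2 : - (PI / 2) < t1 -> t1 < t2 -> t2 < PI / 2 ->
  Re (B (gam t1)) < Re (B (gam t2)).
Proof.
intros H1 H12 H2. apply (locally_increasing (fun t => Re (B (gam t)))); auto.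
intros s Hs. assert (Hs' : - (PI / 2) < s < PI / 2) by lra.
assert (Hst : strip (gam s)) by exact Hs'.
pose proof (shear_derivative_neq_0 _ Hst) as Hn.
assert (Hn' : (- Ci * a (gam s))%C <> RtoC 0).
{ apply Cmult_neq_0; auto. intros Z. apply (f_equal snd) in Z. simpl in Z. lra. }
assert (DA : has_cderiv (fun w => - Ci * A w)%C (gam s) (- Ci * a (gam s))%C) by now apply has_cderiv_scal, HA.
assert (DT : has_cderiv (fun w => - Ci * w)%C (gam s) (- Ci * 1)%C) by apply has_cderiv_scal, has_cderiv_id.
assert (PT : 0 < Re (- Ci * 1 / (- Ci * a (gam s)))%C).
{ replace (- Ci * 1 / (- Ci * a (gam s)))%C with (/ a (gam s))%C.
  - pose proof (Ha _ Hst) as P. destruct (a (gam s)) as [u v]. simpl in *. apply Rdiv_lt_0_compat; nra.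
  - field. split; auto. intros Z. apply (f_equal snd) in Z. simpl in Z. lra. }
assert (PB : 0 < Re (b (gam s) / (- Ci * a (gam s)))%C).
{ replace (b (gam s) / (- Ci * a (gam s)))%C with (Ci * b (gam s) / a (gam s))%C. now apply Hb.
  replace (Ci * b (gam s) / a (gam s))%C with ((Ci * Ci) * b (gam s) / (Ci * a (gam s)))%C.
  replace (Ci * Ci)%C with (- (1))%C by (apply injective_projections; simpl; ring).
  field. split; auto. intros Z. apply (f_equal snd) in Z. simpl in Z. lra.
  field. split; auto. intros Z. apply (f_equal snd) in Z. simpl in Z. lra. }
destruct (local_sign _ _ _ _ _ DA DT Hn' PT) as [d1 [Hd1 L1]].
destruct (local_sign _ _ _ _ _ DA (HB _ Hst) Hn' PB) as [d2 [Hd2 L2]].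
destruct (level_continuous s Hs' (Rmin d1 d2) ltac:(now apply Rmin_pos)) as [d [Hd Hc]].
exists d. split; auto. intros s' Hs1 Hs2 Hne.
specialize (Hc s' ltac:(lra) Hs2).
assert (Hi : Im (- Ci * A (gam s'))%C = Im (- Ci * A (gam s))%C).
{ pose proof (Hxi s Hs') as Q1. pose proof (Hxi s' ltac:(lra)) as Q2. fold (gam s) in Q1. fold (gam s') in Q2.
  unfold Im, Re in *. simpl. lra. }
assert (Hg : gam s' <> gam s) by (intros Z; apply Hne; exact (f_equal snd Z)).
specialize (L1 _ (Rlt_le_trans _ _ _ Hc (Rmin_l _ _)) Hi Hg).
specialize (L2 _ (Rlt_le_trans _ _ _ Hc (Rmin_r _ _)) Hi Hg).
set (r := Re (- Ci * A (gam s'))%C - Re (- Ci * A (gam s))%C) in *.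
replace (Re (- Ci * gam s')%C - Re (- Ci * gam s)%C) with (s' - s) in L1 by (unfold gam; simpl; ring).
set (k := Re (B (gam s')) - Re (B (gam s))) in *.
destruct (Rtotal_order r 0) as [Hr|[Hr|Hr]].
- assert (s' - s < 0) by nra. assert (k < 0) by nra. nra.
- rewrite Hr in L1. lra.
- assert (0 < s' - s) by nra. assert (0 < k) by nra. nra.
Qed.
End Level.

Lemma level_curve c : exists xi : R -> R, forall t, - (PI / 2) < t < PI / 2 -> Re (A (xi t, t)) = c.
Proof.
assert (H : forall t, exists x, - (PI / 2) < t < PI / 2 -> Re (A (x, t)) = c).
{ intros t. destruct (classic (- (PI / 2) < t < PI / 2)) as [Ht|N].
  destruct (level_point t c Ht) as [x Hx]. now exists x. exists 0. tauto. }
exists (fun t => proj1_sig (constructive_indefinite_description _ (H t))).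
intros t. destruct constructive_indefinite_description. auto.
Qed.

(** Two points with the same Re A lie on one level curve, along which Re B is strictly
    monotone. *)
Lemma strip_injective w1 w2 : strip w1 -> strip w2 ->
  Re (A w1) = Re (A w2) -> Re (B w1) = Re (B w2) -> w1 = w2.
Proof.
destruct w1 as [x1 t1], w2 as [x2 t2]. intros H1 H2 EA EB. unfold strip in *; simpl in H1, H2.
destruct (level_curve (Re (A (x1, t1)))) as [xi Hxi].
assert (x1 = xi t1) as -> by (apply (level_unique t1); auto; now rewrite Hxi).
assert (x2 = xi t2) as -> by (apply (level_unique t2); auto; rewrite Hxi; auto).
destruct (Rtotal_order t1 t2) as [H|[<-|H]]; auto; exfalso.
- apply (level_increasing _ _ Hxi) in H; lra.
- apply (level_increasing _ _ Hxi) in H; lra.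
Qed.

(** The level set is the graph of a continuous function of Im w.  It is stated for the
    image point with imaginary part c = - Re A, the form taken by the harmonic map. *)
Lemma strip_level_connected c : connected_set (fun p => exists w, strip w /\ - Re (A w) = c /\ p = (Re (B w), c)).
Proof.
destruct (level_curve (- c)) as [xi Hxi].
assert (K := connected_curve (fun t => (Re (B (xi t, t)), c)) (- (PI / 2)) (PI / 2)).
assert (Q : forall p, (exists w, strip w /\ - Re (A w) = c /\ p = (Re (B w), c)) <->
  (exists t, - (PI / 2) < t < PI / 2 /\ p = (Re (B (xi t, t)), c))).
{ intros p. split.
  - intros [[x t] [Hw [Hc Hp]]]. exists t. split. exact Hw. rewrite Hp. f_equal. do 2 f_equal.
    f_equal. apply (level_unique t); auto. rewrite (Hxi t Hw). lra.
  - intros [t [Ht Hp]]. exists (xi t, t). split. exact Ht. split; auto. rewrite (Hxi t Ht). ring. }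
intros U V HU HV Hcov [p [P1 P2]] [q [Q1 Q2]].
destruct (K) with (U := U) (V := V) as [z Hz]; auto.
- intros t Ht eps He.
  destruct (has_cderiv_lipschitz _ _ _ (HB (xi t, t) Ht)) as [M [d [HM [Hd H]]]].
  destruct (level_continuous _ _ Hxi t Ht (Rmin d (eps / M))) as [d' [Hd' H']].
  { apply Rmin_pos; auto. now apply Rdiv_lt_0_compat. }
  exists d'. split; auto. intros t' Ht' Hdt. specialize (H' t' Ht' Hdt).
  specialize (H _ (Rlt_le_trans _ _ _ H' (Rmin_l _ _))).
  pose proof (Rlt_le_trans _ _ _ H' (Rmin_r _ _)) as H2.
  replace ((Re (B (xi t', t')), c) - (Re (B (xi t, t)), c))%C with (RtoC (Re (B (xi t', t') - B (xi t, t))%C))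
   by (apply injective_projections; simpl; unfold Re; simpl; ring).
  rewrite Cmod_R. eapply Rle_lt_trans. apply re_le_Cmod. eapply Rle_lt_trans. exact H.
  apply Rmult_lt_compat_l with (r := M) in H2; auto.
  replace (M * (eps / M)) with eps in H2 by (field; lra). exact H2.
- intros z Hz. apply Hcov, Q, Hz.
- exists p. split; auto. now apply Q.
- exists q. split; auto. now apply Q.
- exists z. destruct Hz as [Hz1 Hz2]. split; auto. now apply Q.
Qed.
End Strip.

(** * Half-plane estimates *)

Lemma Cmod_sqr_lt x y : Re x ^ 2 + Im x ^ 2 < Re y ^ 2 + Im y ^ 2 -> Cmod x < Cmod y.
Proof.
intros H. rewrite <- !Cmod2_alt in H. apply Rnot_le_lt. intros N.
pose proof (Cmod_ge_0 y). assert (Cmod y ^ 2 <= Cmod x ^ 2) by (apply pow_incr; lra). lra.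
Qed.

Lemma Cmod_sqr_le x y : Re x ^ 2 + Im x ^ 2 <= Re y ^ 2 + Im y ^ 2 -> Cmod x <= Cmod y.
Proof.
intros H. rewrite <- !Cmod2_alt in H. apply Rnot_lt_le. intros N.
pose proof (Cmod_ge_0 y). nra.
Qed.

Lemma Cmod_lt_sqr x y : Cmod x < Cmod y -> Re x ^ 2 + Im x ^ 2 < Re y ^ 2 + Im y ^ 2.
Proof. intros H. rewrite <- !Cmod2_alt. pose proof (Cmod_ge_0 x). nra. Qed.

Lemma Cmod_lt1_sqr x : Cmod x < 1 -> Re x ^ 2 + Im x ^ 2 < 1.
Proof. intros H. rewrite <- Cmod2_alt. pose proof (Cmod_ge_0 x). nra. Qed.

(** The map u |-> 1/(1+u) sends the unit disk onto the half-plane Re > 1/2. *)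
Lemma Re_inv_gt_half u : Cmod u < 1 -> 1 / 2 < Re (/ (1 + u))%C.
Proof.
intros H. apply Cmod_lt1_sqr in H. destruct u as [x y]. simpl in *.
assert (P : 0 < (1 + x) * ((1 + x) * 1) + (0 + y) * ((0 + y) * 1)) by nra.
apply Rmult_lt_reg_r with (1 := P). match goal with |- _ < ?u => replace u with (1 + x) by (field; lra) end. nra.
Qed.

Lemma Re_cayley_pos H G : Cmod G < Cmod H -> 0 < Re ((H + G) / (H - G))%C.
Proof.
intros L. apply Cmod_lt_sqr in L. destruct H as [p q], G as [r s]. simpl in *.
match goal with |- 0 < ?u => replace u with ((p ^ 2 + q ^ 2 - r ^ 2 - s ^ 2) / ((p + - r) ^ 2 + (q + - s) ^ 2)) end.
apply Rdiv_lt_0_compat. nra.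
assert (p + - r <> 0 \/ q + - s <> 0) as [N|N].
{ destruct (Req_dec p r). right. intros Z. assert (q = s) by lra. subst. lra. left. lra. }
- apply pow2_gt_0 in N. pose proof (pow2_ge_0 (q + - s)). lra.
- apply pow2_gt_0 in N. pose proof (pow2_ge_0 (p + - r)). lra.
- field. intros Z.
  assert (Z1 : (p - r) ^ 2 + (q - s) ^ 2 = 0) by (rewrite <- Z; ring).
  pose proof (pow2_ge_0 (p - r)). pose proof (pow2_ge_0 (q - s)).
  assert (p = r) by nra. assert (q = s) by nra. subst. lra.
Qed.

(** Y is at least as close to k as to 0 when it lies to the right of the bisector
    Re = k/2. *)
Lemma Cmod_reflect k Y : 0 <= k -> k / 2 <= Re Y -> Cmod (RtoC k - Y)%C <= Cmod Y.
Proof. intros Hk HY. apply Cmod_sqr_le. destruct Y as [x y]. simpl in *. nra. Qed.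

(** The principal logarithm on the right half-plane, with argument atan (q/p). *)
Lemma log_exists p q : 0 < p -> exists w, strip w /\ Cexp w = (p, q).
Proof.
intros Hp. exists (ln (p * sqrt (1 + (q / p) ^ 2)), atan (q / p)).
split. unfold strip; simpl. pose proof (atan_bound (q / p)). lra.
assert (Hs : 0 < 1 + (q / p) ^ 2) by (pose proof (pow2_ge_0 (q / p)); lra).
pose proof (sqrt_lt_R0 _ Hs) as Hr.
unfold Cexp. simpl Re. simpl Im. rewrite exp_ln by (apply Rmult_lt_0_compat; auto).
rewrite cos_atan, sin_atan. replace ((q / p)²) with ((q / p) ^ 2) by (unfold Rsqr; ring).
set (r := sqrt _) in *.
apply injective_projections; simpl; field; lra.
Qed.

Lemma Re_Cexp_pos w : strip w -> 0 < Re (Cexp w).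
Proof.
intros H. destruct w as [x t]. unfold strip in H. simpl in H. unfold Cexp; simpl.
pose proof (cos_gt_0 t ltac:(lra) ltac:(lra)). pose proof (exp_pos x). nra.
Qed.

Lemma linear_plus_neq_0 al z : Cmod al = 1 -> E z -> (1 + al * z)%C <> RtoC 0.
Proof.
intros Hal Hz. replace (1 + al * z)%C with (1 - (- al) * z)%C by ring.
apply linear_factor_neq_0; auto. rewrite Cmod_opp. lra.
Qed.

Lemma is_pser_div_linear_plus al a f : Cmod al = 1 -> is_pser a f ->
  is_pser (geom_coef (- al) a) (fun z => f z / (1 + al * z))%C.
Proof.
intros Hal H. eapply is_pser_ext. 3: apply is_pser_div_linear; [|exact H]. reflexivity.
intros z Hz. simpl. f_equal. ring. rewrite Cmod_opp. lra.
Qed.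

(** * A conformal map of the strip onto the disk *)

Section StripMap.
Variables c s : R.
Hypothesis Hcs : c ^ 2 + s ^ 2 = 1.
Hypothesis Hs : 0 < s.
Let k : C := (c, s).
Let k' : C := (c, - s).

(** Inverse of w = log (i (1 + k z)/(z + k)).  Up to an additive constant, w is the
    given logarithm of (1 + k z)/(1 + k' z); the constant is chosen so that the strip
    is symmetric about the real axis. *)
Definition strip_map (k w : C) : C := (- ((1 + Ci * k * Cexp w) / (k + Ci * Cexp w)))%C.

Lemma strip_map_den w : strip w -> (k + Ci * Cexp w)%C <> RtoC 0.
Proof.
intros Hw Z. pose proof (Re_Cexp_pos w Hw) as P. apply (f_equal snd) in Z. unfold k in Z.
destruct (Cexp w) as [p q]. simpl in *. lra.
Qed.

Lemma strip_map_E w : strip w -> E (strip_map k w).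
Proof.
intros Hw. unfold E, strip_map. pose proof (strip_map_den w Hw) as N.
rewrite Cmod_opp, Cmod_div by auto.
pose proof (proj1 (Cmod_gt_0 _) N) as M.
apply Rmult_lt_reg_r with (1 := M). unfold Rdiv. rewrite Rmult_assoc, Rinv_l, Rmult_1_l, Rmult_1_r by lra.
apply Cmod_sqr_lt. pose proof (Re_Cexp_pos w Hw) as P. unfold k.
destruct (Cexp w) as [p q]. simpl in P |- *. 
assert (0 < s * p) by nra.
match goal with |- ?u < ?v => replace u with (1 - 2 * (c * q + s * p) + (c ^ 2 + s ^ 2) * (p ^ 2 + q ^ 2)) by ring;
 replace v with ((c ^ 2 + s ^ 2) - 2 * c * q + 2 * s * p + p ^ 2 + q ^ 2) by ring end.
rewrite Hcs. lra.
Qed.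

Lemma k_mul_k' : (k * k')%C = RtoC 1.
Proof. apply injective_projections; simpl; [rewrite <- Hcs|]; ring. Qed.

Lemma k_minus_k' : (k - k')%C = (2 * Ci * RtoC s)%C.
Proof. apply injective_projections; simpl; ring. Qed.

Lemma Cmod_k : Cmod k = 1.
Proof. unfold Cmod, k. simpl. replace (c * (c * 1) + s * (s * 1)) with 1 by lra. apply sqrt_1. Qed.

Lemma Cmod_k' : Cmod k' = 1.
Proof. unfold Cmod, k'. simpl. replace (c * (c * 1) + - s * (- s * 1)) with 1 by lra. apply sqrt_1. Qed.

Lemma strip_map_onto z : E z -> exists w, strip w /\ strip_map k w = z.
Proof.
intros Hz.
assert (N : (z + k)%C <> RtoC 0).
{ intros Z. apply (linear_plus_neq_0 k' z Cmod_k' Hz). rewrite <- k_mul_k'. replace (k * k' + k' * z)%C with (k' * (z + k))%C by ring. rewrite Z. ring. }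
set (v := (Ci * ((1 + k * z) / (z + k)))%C).
assert (Hv : 0 < Re v).
{ pose proof Hz as Hz'. apply Cmod_lt1_sqr in Hz'.
  pose proof (proj1 (Cmod_gt_0 _) N) as M. unfold v, k in *. destruct z as [x y].
  assert (M2 : 0 < (x + c) ^ 2 + (y + s) ^ 2).
  { assert (0 < Cmod ((x, y) + (c, s))%C ^ 2) by (apply pow_lt; auto). rewrite Cmod2_alt in H. exact H. }
  simpl in Hz'. simpl.
  match goal with |- 0 < ?u => replace u with (((c ^ 2 + s ^ 2) * (- y) + s + y - s * (x ^ 2 + y ^ 2)) / ((x + c) ^ 2 + (y + s) ^ 2)) by (field; lra) end.
  apply Rdiv_lt_0_compat; auto. rewrite Hcs. nra. }
destruct v as [p q] eqn:Ev. simpl in Hv. destruct (log_exists p q Hv) as [w [Hw1 Hw2]].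
exists w. split; auto. pose proof (strip_map_den w Hw1) as D. unfold strip_map.
rewrite Hw2, <- Ev in *. unfold v in *.
assert (I2 : (Ci * Ci)%C = (- (1))%C) by (apply injective_projections; simpl; ring).
replace (1 + Ci * k * (Ci * ((1 + k * z) / (z + k))))%C with (1 + (Ci * Ci) * (k * ((1 + k * z) / (z + k))))%C by ring.
replace (k + Ci * (Ci * ((1 + k * z) / (z + k))))%C with (k + (Ci * Ci) * ((1 + k * z) / (z + k)))%C in * by ring.
rewrite I2 in *.
assert (D2 : (k * k - 1)%C <> RtoC 0).
{ intros Z. apply D. replace (k + - (1) * ((1 + k * z) / (z + k)))%C with ((k * k - 1) / (z + k))%C by (field; auto). rewrite Z. field. auto. }
field. repeat split; auto.
intros Z. apply D2. rewrite <- Z. ring.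
Qed.

Lemma k_minus_neq_0 : (k - k')%C <> RtoC 0.
Proof. rewrite k_minus_k'. intros Z. apply (f_equal snd) in Z. simpl in Z. lra. Qed.

(** These factorizations turn z/((1+kz)(1+k'z)) and the derivative of the map into
    expressions in e^w. *)
Lemma strip_map_factor w : strip w ->
  (1 + k * strip_map k w = - (Ci * Cexp w * k * (k - k')) / (k + Ci * Cexp w))%C /\
  (1 + k' * strip_map k w = (k - k') / (k + Ci * Cexp w))%C.
Proof.
intros Hw. pose proof (strip_map_den w Hw) as D. unfold strip_map. split.
- replace (Ci * Cexp w * k * (k - k'))%C with (Ci * Cexp w * (k * k - k * k'))%C by ring. rewrite k_mul_k'.
  field. auto.
- replace (k' * - ((1 + Ci * k * Cexp w) / (k + Ci * Cexp w)))%C with (- ((k' + Ci * (k * k') * Cexp w) / (k + Ci * Cexp w)))%C by (field; auto).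
  rewrite k_mul_k'. field. auto.
Qed.

Lemma has_cderiv_strip_map w : strip w ->
  has_cderiv (strip_map k) w ((1 + k * strip_map k w) * (1 + k' * strip_map k w) / (2 * Ci * RtoC s))%C.
Proof.
intros Hw. pose proof (strip_map_den w Hw) as D. destruct (strip_map_factor w Hw) as [F1 F2].
pose proof k_minus_neq_0 as N.
rewrite F1, F2, <- k_minus_k'.
replace (- (Ci * Cexp w * k * (k - k')) / (k + Ci * Cexp w) * ((k - k') / (k + Ci * Cexp w)) / (k - k'))%C
 with ((- (1)) * ((0 + Ci * k * Cexp w) * (k + Ci * Cexp w) - (1 + Ci * k * Cexp w) * (0 + Ci * Cexp w)) / ((k + Ci * Cexp w) * (k + Ci * Cexp w)))%C.
2:{ replace (Ci * Cexp w * k * (k - k'))%C with (Ci * Cexp w * (k * k - k * k'))%C by ring. rewrite k_mul_k'.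
  transitivity (- (Ci * Cexp w * (k * k - 1)) / ((k + Ci * Cexp w) * (k + Ci * Cexp w)))%C; field; auto. }
apply (has_cderiv_ext_ball (fun w => - (1) * ((1 + Ci * k * Cexp w) / (k + Ci * Cexp w)))%C _ _ _ 1). lra.
intros y _. unfold strip_map. ring.
unfold Cdiv. rewrite <- Cmult_assoc. apply has_cderiv_scal.
apply (has_cderiv_div (fun w => 1 + Ci * k * Cexp w)%C (fun w => k + Ci * Cexp w)%C). auto.
apply has_cderiv_plus. apply has_cderiv_const. apply has_cderiv_scal, has_cderiv_Cexp.
apply has_cderiv_plus. apply has_cderiv_const. apply has_cderiv_scal, has_cderiv_Cexp.
Qed.

(** In the coordinate w the slit map z/((1+kz)(1+k'z)) is
    - (c + i sinh w) / (2 s^2). *)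
Lemma koebe_slit_strip x t : strip (x, t) -> let z := strip_map k (x, t) in
  Re (Ci * (z / ((1 + k * z) * (1 + k' * z))))%C = (exp x - exp (- x)) * cos t / (4 * s ^ 2).
Proof.
intros Hw z. pose proof (strip_map_den _ Hw) as D. destruct (strip_map_factor _ Hw) as [F1 F2].
pose proof k_minus_neq_0 as N. pose proof (Cexp_neq_0 (x, t)) as NE.
assert (NI : Ci <> RtoC 0) by (intros Z; apply (f_equal snd) in Z; simpl in Z; lra).
assert (Nk : k <> RtoC 0) by (intros Z; apply (f_equal snd) in Z; simpl in Z; lra).
assert (Q : (Ci * (z / ((1 + k * z) * (1 + k' * z))))%C = (Ci * ((k + k') + Ci * (Cexp (x, t) - / Cexp (x, t))) / ((k - k') * (k - k')))%C).
{ unfold z. rewrite F1, F2. unfold strip_map. set (e := Cexp (x, t)) in *.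
  assert (I2 : (/ Ci)%C = (- Ci)%C) by (apply injective_projections; simpl; field).
  transitivity ((1 + Ci * k * e) * (k + Ci * e) / (e * k * ((k - k') * (k - k'))))%C.
  field. repeat split; auto.
  assert (I3 : (Ci * Ci)%C = (- (1))%C) by (apply injective_projections; simpl; ring).
  replace ((1 + Ci * k * e) * (k + Ci * e))%C with (k + Ci * e + Ci * (k * k) * e + (Ci * Ci) * k * (e * e))%C by ring.
  replace (Ci * (k + k' + Ci * (e - / e)) / ((k - k') * (k - k')))%C with
    ((Ci * (k * k) * e + Ci * (k * k') * e + (Ci * Ci) * k * (e * e - 1)) / (e * k * ((k - k') * (k - k'))))%C.
  rewrite k_mul_k', I3. f_equal. ring.
  field. repeat split; auto. }
rewrite Q, k_minus_k'.
replace (/ Cexp (x, t))%C with (Cexp (- (x, t))%C).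
2:{ assert (P : (Cexp (x, t) * Cexp (- (x, t)))%C = RtoC 1) by (rewrite <- Cexp_plus; replace ((x, t) + - (x, t))%C with (RtoC 0) by ring; apply Cexp_0).
  replace (Cexp (- (x, t))%C) with ((Cexp (x, t) * Cexp (- (x, t))) / Cexp (x, t))%C by (field; auto). rewrite P. field; auto. }
unfold Cexp, k, k'. simpl. rewrite cos_neg, sin_neg. field. lra.
Qed.
End StripMap.

(** * The convolution *)

Lemma line_0 p w : line 0 p w <-> Im w = Im p.
Proof.
unfold line. replace (Cexp (Ci * 0))%C with (RtoC 1).
2:{ rewrite Cmult_0_r. now rewrite Cexp_0. }
split.
- intros [t ->]. unfold Im; simpl. ring.
- intros H. exists (Re w - Re p). unfold Re, Im in *. apply injective_projections; simpl; lra.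
Qed.

Section Convolution.
Variables c s lam mu : R.
Variable eps : C.
Variables h g : C -> C.
Hypothesis Hcs : c ^ 2 + s ^ 2 = 1.
Hypothesis Hs : 0 < s.
Hypothesis Hlam : 0 < lam <= 2 * mu.
Hypothesis Heps : Cmod eps = 1.
Let k : C := (c, s).
Let k' : C := (c, - s).
Let p1 (z : C) : C := (1 + k * z)%C.
Let p2 (z : C) : C := (1 + k' * z)%C.
Let p3 (z : C) : C := (1 + eps * z)%C.
Let h1 (z : C) : C := (1 / p1 z / p2 z / p3 z)%C.
Hypothesis Hh : forall z, E z -> has_cderiv h z (h1 z).
Hypothesis Hg : forall z, E z -> has_cderiv g z (eps * (z * h1 z))%C.

Let p1_neq z : E z -> p1 z <> RtoC 0.
Proof. intros Hz. apply linear_plus_neq_0; auto. now apply Cmod_k. Qed.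
Let p2_neq z : E z -> p2 z <> RtoC 0.
Proof. intros Hz. apply linear_plus_neq_0; auto. now apply Cmod_k'. Qed.
Let p3_neq z : E z -> p3 z <> RtoC 0.
Proof. intros Hz. apply linear_plus_neq_0; auto. Qed.

(** X = z h''/h' and Y = H'/h'. *)
Let X (z : C) : C := (/ p1 z + / p2 z + / p3 z - 3)%C.
Let Y (z : C) : C := (RtoC lam + RtoC mu + RtoC lam * X z)%C.

Definition convH (z : C) : C := (RtoC lam * (z * h1 z) + RtoC mu * h z)%C.
Definition convG (z : C) : C := (- RtoC lam * (z * (eps * (z * h1 z))) + RtoC mu * g z)%C.

Lemma h1_pser : exists a, is_pser a h1.
Proof.
eexists.
exact (is_pser_div_linear_plus _ _ _ Heps (is_pser_div_linear_plus _ _ _ (Cmod_k' c s Hcs)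
  (is_pser_div_linear_plus _ _ _ (Cmod_k c s Hcs) (is_pser_const (RtoC 1))))).
Qed.

Lemma h1_derive z : E z -> has_cderiv h1 z (- h1 z * (k / p1 z + k' / p2 z + eps / p3 z))%C.
Proof.
intros Hz. pose proof (p1_neq z Hz); pose proof (p2_neq z Hz); pose proof (p3_neq z Hz).
pose proof (fun al => has_cderiv_linear_factor al z) as D.
pose proof (has_cderiv_div _ _ z _ _ H (has_cderiv_const 1 z) (D k)) as D1.
pose proof (has_cderiv_div _ _ z _ _ H0 D1 (D k')) as D2.
pose proof (has_cderiv_div _ _ z _ _ H1 D2 (D eps)) as D3.
match type of D3 with has_cderiv _ _ ?l => replace (- h1 z * (k / p1 z + k' / p2 z + eps / p3 z))%C with l end.
exact D3. cbv beta. fold (p1 z). fold (p2 z). fold (p3 z). unfold h1. field. auto.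
Qed.

Lemma z_log_derivative z : E z -> (z * (- h1 z * (k / p1 z + k' / p2 z + eps / p3 z)) = h1 z * X z)%C.
Proof.
intros Hz. pose proof (p1_neq z Hz); pose proof (p2_neq z Hz); pose proof (p3_neq z Hz).
unfold X.
replace (z * (- h1 z * (k / p1 z + k' / p2 z + eps / p3 z)))%C with
  (- h1 z * ((k * z) / p1 z + (k' * z) / p2 z + (eps * z) / p3 z))%C by (field; auto).
replace (k * z)%C with (p1 z - 1)%C by (unfold p1; ring).
replace (k' * z)%C with (p2 z - 1)%C by (unfold p2; ring).
replace (eps * z)%C with (p3 z - 1)%C by (unfold p3; ring).
field; auto.
Qed.

Lemma convH_derive z : E z -> has_cderiv convH z (h1 z * Y z)%C.
Proof.
intros Hz.
pose proof (has_cderiv_plus _ _ _ _ _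
  (has_cderiv_scal (RtoC lam) _ _ _ (has_cderiv_mult _ _ _ _ _ (has_cderiv_id z) (h1_derive z Hz)))
  (has_cderiv_scal (RtoC mu) _ _ _ (Hh z Hz))) as D.
rewrite z_log_derivative in D by auto. 
replace (h1 z * Y z)%C with (RtoC lam * (1 * h1 z + h1 z * X z) + RtoC mu * h1 z)%C by (unfold Y; ring).
exact D.
Qed.

Lemma convH_derive_at_0 : (h1 (RtoC 0) * Y (RtoC 0))%C = RtoC (lam + mu).
Proof.
unfold Y, X, h1, p1, p2, p3.
assert (T : forall al, (1 + al * 0)%C = RtoC 1) by (intros; ring). rewrite !T.
rewrite RtoC_plus. field.
Qed.

Lemma convG_derive z : E z -> has_cderiv convG z (eps * z * h1 z * (RtoC (2 * mu - lam) - Y z))%C.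
Proof.
intros Hz.
pose proof (has_cderiv_mult _ _ _ _ _ (has_cderiv_id z) (h1_derive z Hz)) as D0.
rewrite z_log_derivative in D0 by auto.
pose proof (has_cderiv_plus _ _ _ _ _
  (has_cderiv_scal (- RtoC lam)%C _ _ _ (has_cderiv_mult _ _ _ _ _ (has_cderiv_id z) (has_cderiv_scal eps _ _ _ D0)))
  (has_cderiv_scal (RtoC mu) _ _ _ (Hg z Hz))) as D.
match type of D with has_cderiv _ _ ?l => replace (eps * z * h1 z * (RtoC (2 * mu - lam) - Y z))%C with l end.
exact D. unfold Y. rewrite RtoC_minus, RtoC_mult. ring.
Qed.

Lemma Re_inv_factor al z : Cmod al = 1 -> E z -> 1 / 2 < Re (/ (1 + al * z))%C.
Proof. intros Ha Hz. apply Re_inv_gt_half. rewrite Cmod_mult, Ha. unfold E in Hz. lra. Qed.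

Lemma Re_Y z : E z -> (2 * mu - lam) / 2 < Re (Y z).
Proof.
intros Hz.
pose proof (Re_inv_factor k z (Cmod_k c s Hcs) Hz) as R1.
pose proof (Re_inv_factor k' z (Cmod_k' c s Hcs) Hz) as R2.
pose proof (Re_inv_factor eps z Heps Hz) as R3.
fold (p1 z) in R1. fold (p2 z) in R2. fold (p3 z) in R3.
assert (Q : Re (Y z) = lam + mu + lam * (Re (/ p1 z)%C + Re (/ p2 z)%C + Re (/ p3 z)%C - 3)).
{ unfold Y, X. generalize (/ p1 z)%C (/ p2 z)%C (/ p3 z)%C. intros [a1 b1] [a2 b2] [a3 b3]. simpl. ring. }
rewrite Q. nra.
Qed.

Lemma h1_neq z : E z -> h1 z <> RtoC 0.
Proof.
intros Hz Z. pose proof (p1_neq z Hz); pose proof (p2_neq z Hz); pose proof (p3_neq z Hz).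
assert (h1 z * (p1 z * p2 z * p3 z) = 1)%C by (unfold h1; field; auto).
rewrite Z in H2. apply (f_equal fst) in H2. simpl in H2. lra.
Qed.

(** The common factor h' cancels, |eps z| < 1, and [Cmod_reflect] applies by [Re_Y];
    lam <= 2 mu makes its constant 2 mu - lam nonnegative. *)
Lemma conv_sense_preserving z : E z ->
  Cmod (eps * z * h1 z * (RtoC (2 * mu - lam) - Y z))%C < Cmod (h1 z * Y z)%C.
Proof.
intros Hz. rewrite !Cmod_mult, Heps.
pose proof (Re_Y z Hz) as HY.
pose proof (proj1 (Cmod_gt_0 _) (h1_neq z Hz)) as Hp.
assert (HR : Cmod (RtoC (2 * mu - lam) - Y z)%C <= Cmod (Y z)) by (apply Cmod_reflect; lra).
assert (HY0 : 0 < Cmod (Y z)).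
{ eapply Rlt_le_trans. 2: apply re_le_Cmod. eapply Rlt_le_trans. 2: apply Rle_abs. lra. }
unfold E in Hz. pose proof (Cmod_ge_0 z).
pose proof (Cmod_ge_0 (RtoC (2 * mu - lam) - Y z)%C).
assert (Cmod z * Cmod (RtoC (2 * mu - lam) - Y z)%C < Cmod (Y z)) by nra.
nra.
Qed.

Let P (z : C) : C := (RtoC lam * (/ p1 z + / p2 z - 1) + RtoC mu * (2 / p3 z - 1))%C.

Lemma conv_diff_derivative z : E z ->
  (h1 z * Y z - eps * z * h1 z * (RtoC (2 * mu - lam) - Y z) = P z / (p1 z * p2 z))%C.
Proof.
intros Hz. pose proof (p1_neq z Hz); pose proof (p2_neq z Hz); pose proof (p3_neq z Hz).
unfold Y, X, P, h1. replace (eps * z)%C with (p3 z - 1)%C by (unfold p3; ring).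
rewrite RtoC_minus, RtoC_mult.
field. auto.
Qed.

(** Both brackets have positive real part: the first since 1/(1+kz) and 1/(1+k'z) have
    real part > 1/2, the second since 2/(1+eps z) - 1 = (1 - eps z)/(1 + eps z). *)
Lemma Re_P z : E z -> 0 < Re (P z).
Proof.
intros Hz.
pose proof (Re_inv_factor k z (Cmod_k c s Hcs) Hz) as R1.
pose proof (Re_inv_factor k' z (Cmod_k' c s Hcs) Hz) as R2.
pose proof (Re_inv_factor eps z Heps Hz) as R3.
fold (p1 z) in R1. fold (p2 z) in R2. fold (p3 z) in R3.
assert (Q : Re (P z) = lam * (Re (/ p1 z)%C + Re (/ p2 z)%C - 1) + mu * (2 * Re (/ p3 z)%C - 1)).
{ unfold P, Cdiv. generalize (/ p1 z)%C (/ p2 z)%C (/ p3 z)%C. intros [a1 b1] [a2 b2] [a3 b3]. simpl. ring. }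
rewrite Q. apply Rplus_lt_0_compat; apply Rmult_lt_0_compat; lra.
Qed.

Let W := strip_map k.
(** Its real part is minus the imaginary part of the harmonic map, and its derivative is
    P / (2 s). *)
Let shear_w (w : C) : C := (Ci * (convH (W w) - convG (W w)))%C.
Let sum_w (w : C) : C := (convH (W w) + convG (W w))%C.

Lemma has_cderiv_on_strip F w f : strip w -> has_cderiv F (W w) f ->
  has_cderiv (fun w => F (W w)) w (f * (p1 (W w) * p2 (W w) / (2 * Ci * RtoC s)))%C.
Proof.
intros Hw HF. apply (has_cderiv_comp F W). auto. now apply has_cderiv_strip_map.
Qed.

Lemma Ci_scaled q z : E z -> (Ci * (q / (p1 z * p2 z) * (p1 z * p2 z / (2 * Ci * RtoC s))) = RtoC (/ (2 * s)) * q)%C.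
Proof.
intros Hz. pose proof (p1_neq z Hz); pose proof (p2_neq z Hz).
rewrite RtoC_inv, RtoC_mult by lra. field.
repeat split; auto; intros Z; [apply (f_equal fst) in Z | apply (f_equal snd) in Z]; simpl in Z; lra.
Qed.

Lemma shear_w_derive w : strip w -> has_cderiv shear_w w (RtoC (/ (2 * s)) * P (W w))%C.
Proof.
intros Hw. assert (Hz : E (W w)) by now apply strip_map_E.
rewrite <- Ci_scaled with (z := W w), <- conv_diff_derivative by auto.
apply has_cderiv_scal.
apply (has_cderiv_on_strip (fun z => convH z - convG z)%C); auto.
apply has_cderiv_minus. now apply convH_derive. now apply convG_derive.
Qed.

Lemma sum_w_derive w : strip w -> has_cderiv sum_w w
  ((h1 (W w) * Y (W w) + eps * W w * h1 (W w) * (RtoC (2 * mu - lam) - Y (W w))) * (p1 (W w) * p2 (W w) / (2 * Ci * RtoC s)))%C.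
Proof.
intros Hw. assert (Hz : E (W w)) by now apply strip_map_E.
apply (has_cderiv_on_strip (fun z => convH z + convG z)%C); auto.
apply has_cderiv_plus. now apply convH_derive. now apply convG_derive.
Qed.

Lemma Re_scaled r q : Re (RtoC r * q)%C = r * Re q.
Proof. destruct q. simpl. ring. Qed.

Lemma Re_shear_w_derive_pos w : strip w -> 0 < Re (RtoC (/ (2 * s)) * P (W w))%C.
Proof.
intros Hw. rewrite Re_scaled. apply Rmult_lt_0_compat. apply Rinv_0_lt_compat; lra.
apply Re_P. now apply strip_map_E.
Qed.

(** The factor i and the derivative of the strip map cancel, leaving
    (H' + G')/(H' - G'), whose real part is positive because |G'| < |H'|. *)
Lemma sum_shear_ratio_pos w : strip w -> 0 < Re (Ci * ((h1 (W w) * Y (W w) + eps * W w * h1 (W w) * (RtoC (2 * mu - lam) - Y (W w))) * (p1 (W w) * p2 (W w) / (2 * Ci * RtoC s)))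
   / (RtoC (/ (2 * s)) * P (W w)))%C.
Proof.
intros Hw. assert (Hz : E (W w)) by now apply strip_map_E.
pose proof (Re_shear_w_derive_pos w Hw) as Pp.
pose proof (p1_neq _ Hz); pose proof (p2_neq _ Hz).
rewrite <- Ci_scaled with (z := W w) in * by auto.
rewrite <- conv_diff_derivative in * by auto.
pose proof (Re_cayley_pos _ _ (conv_sense_preserving _ Hz)) as Q.
set (Hd := (h1 (W w) * Y (W w))%C) in *. set (Gd := (eps * W w * h1 (W w) * (RtoC (2 * mu - lam) - Y (W w)))%C) in *.
assert (N : (Hd - Gd)%C <> RtoC 0).
{ intros Z. rewrite Z in Pp. rewrite Cmult_0_l, Cmult_0_r in Pp. simpl in Pp. lra. }
match goal with |- 0 < Re ?u => replace u with ((Hd + Gd) / (Hd - Gd))%C end. exact Q.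
field. repeat split; auto.
all: intros Z; first [apply (f_equal fst) in Z; simpl in Z; lra | apply (f_equal snd) in Z; simpl in Z; lra].
Qed.

Let diff_w (w : C) : C := (Ci * (h (W w) - g (W w)))%C.

Lemma diff_w_derive w : strip w -> has_cderiv diff_w w (RtoC (/ (2 * s)) * (2 / p3 (W w) - 1))%C.
Proof.
intros Hw. assert (Hz : E (W w)) by now apply strip_map_E.
pose proof (p1_neq _ Hz); pose proof (p2_neq _ Hz); pose proof (p3_neq _ Hz).
rewrite <- Ci_scaled with (z := W w) by auto.
apply has_cderiv_scal.
apply (has_cderiv_on_strip (fun z => h z - g z)%C); auto.
replace ((2 / p3 (W w) - 1) / (p1 (W w) * p2 (W w)))%C with (h1 (W w) - eps * (W w * h1 (W w)))%C.
apply has_cderiv_minus; auto.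
unfold h1. replace (eps * (W w * (1 / p1 (W w) / p2 (W w) / p3 (W w))))%C with ((p3 (W w) - 1) * (1 / p1 (W w) / p2 (W w) / p3 (W w)))%C by (unfold p3 at 1; ring).
field. auto.
Qed.

(** h - g is itself a shear of the same strip map, with (1 - eps z)/(1 + eps z) in
    place of P. *)
Lemma Re_diff_w_increasing t x y : - (PI / 2) < t < PI / 2 -> x < y -> Re (diff_w (x, t)) < Re (diff_w (y, t)).
Proof.
intros Ht. apply (strip_line_increasing diff_w (fun w => RtoC (/ (2 * s)) * (2 / p3 (W w) - 1))%C).
- intros u. now apply diff_w_derive.
- intros u. rewrite Re_scaled. apply Rmult_lt_0_compat. apply Rinv_0_lt_compat; lra.
  assert (Hz : E (W (u, t))) by (apply strip_map_E; auto).
  pose proof (Re_inv_factor eps _ Heps Hz) as R3. fold (p3 (W (u, t))) in R3.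
  unfold Cdiv. revert R3. generalize (/ p3 (W (u, t)))%C. intros [a b]. simpl. lra.
Qed.

(** H - G = lam z (h' + g') + mu (h - g), and z (h' + g') is the slit map, because the
    factor 1 + eps z cancels the one in h'. *)
Lemma Re_shear_w_split x t : strip (x, t) ->
  Re (shear_w (x, t)) = lam * ((exp x - exp (- x)) * cos t / (4 * s ^ 2)) + mu * Re (diff_w (x, t)).
Proof.
intros Hw. assert (Hz : E (W (x, t))) by now apply strip_map_E.
pose proof (p1_neq _ Hz); pose proof (p2_neq _ Hz); pose proof (p3_neq _ Hz).
rewrite <- (koebe_slit_strip c s Hcs Hs x t Hw).
rewrite <- !Re_scaled.
assert (RP : forall u v, Re (u + v)%C = Re u + Re v) by reflexivity. rewrite <- RP. f_equal.
unfold shear_w, diff_w, convH, convG. fold k k'. fold W. set (z := W (x, t)) in *. fold (p1 z) (p2 z).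
replace (RtoC lam * (z * h1 z) + RtoC mu * h z - (- RtoC lam * (z * (eps * (z * h1 z))) + RtoC mu * g z))%C
 with (RtoC lam * (z * (h1 z * p3 z)) + RtoC mu * (h z - g z))%C by (unfold p3; ring).
unfold h1. field. auto.
Qed.

(** The sinh summand is unbounded in both directions and the other summand is monotone
    in the same direction, so it cannot compensate. *)
Lemma Re_shear_w_unbounded t d : - (PI / 2) < t < PI / 2 ->
  (exists x, Re (shear_w (x, t)) < d) /\ (exists x, d < Re (shear_w (x, t))).
Proof.
intros Ht.
assert (Hc : 0 < cos t) by (apply cos_gt_0; lra).
assert (Hs2 : 0 < 4 * s ^ 2) by nra.
assert (Hmu : 0 < mu) by lra.
set (q := lam * (cos t / (4 * s ^ 2))).
assert (Hq : 0 < q) by (apply Rmult_lt_0_compat; [lra | now apply Rdiv_lt_0_compat]).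
set (m := mu * Re (diff_w (0, t))).
(* exp x - exp (-x) > x, so this x already beats the bounded offset m *)
set (x := (Rabs (d - m) + 1) / q).
assert (Hx : 0 < x) by (apply Rdiv_lt_0_compat; auto; pose proof (Rabs_pos (d - m)); lra).
assert (Hqx : q * x = Rabs (d - m) + 1) by (unfold x; field; lra).
assert (He : x < exp x - exp (- x)).
{ pose proof (exp_ineq1 x ltac:(lra)). pose proof (exp_increasing (- x) 0 ltac:(lra)). rewrite exp_0 in *. lra. }
assert (Hb : q * x < q * (exp x - exp (- x))) by now apply Rmult_lt_compat_l.
assert (Hl : forall y, lam * ((exp y - exp (- y)) * cos t / (4 * s ^ 2)) = q * (exp y - exp (- y))) by (intros; unfold q; field; lra).
pose proof (Rle_abs (d - m)). pose proof (Rle_abs (- (d - m))). rewrite Rabs_Ropp in *.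
split; [exists (- x) | exists x]; rewrite Re_shear_w_split, Hl by auto.
- pose proof (Re_diff_w_increasing t (- x) 0 Ht ltac:(lra)) as I.
  apply (Rmult_lt_compat_l mu) in I; auto. fold m in I. rewrite Ropp_involutive. lra.
- pose proof (Re_diff_w_increasing t 0 x Ht ltac:(lra)) as I.
  apply (Rmult_lt_compat_l mu) in I; auto. fold m in I. lra.
Qed.

Lemma harm_parts z : Re (harm convH convG z) = Re (convH z + convG z)%C /\
   Im (harm convH convG z) = - Re (Ci * (convH z - convG z))%C.
Proof. unfold harm. split; simpl; unfold Re, Im; ring. Qed.

Lemma conv_univalent : univalent (harm convH convG).
Proof.
intros z1 z2 H1 H2 He.
destruct (strip_map_onto c s Hcs Hs z1 H1) as [w1 [S1 <-]].
destruct (strip_map_onto c s Hcs Hs z2 H2) as [w2 [S2 <-]].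
f_equal.
destruct (harm_parts (strip_map k w1)) as [R1 I1]. destruct (harm_parts (strip_map k w2)) as [R2 I2].
fold k in He. rewrite He in R1, I1.
apply (strip_injective shear_w sum_w _ _ shear_w_derive sum_w_derive Re_shear_w_derive_pos sum_shear_ratio_pos Re_shear_w_unbounded); trivial; unfold shear_w, sum_w, W; lra.
Qed.

Lemma conv_convex_real : convex_in_real_direction (harm convH convG).
Proof.
intros p. 
eapply connected_set_ext. 2: apply (strip_level_connected shear_w sum_w _ _ shear_w_derive sum_w_derive Re_shear_w_derive_pos Re_shear_w_unbounded (Im p)).
intros v. rewrite line_0. split.
- intros [w [Hw [Hc ->]]]. split; [|reflexivity].
  exists (W w). split. now apply strip_map_E.
  destruct (harm_parts (W w)) as [R1 I1]. apply injective_projections.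
  exact R1. exact (eq_trans I1 Hc).
- intros [[z [Hz <-]] Hi].
  destruct (strip_map_onto c s Hcs Hs z Hz) as [w [Sw <-]]. fold k in Hi |- *.
  destruct (harm_parts (strip_map k w)) as [R1 I1].
  exists w. split; auto. unfold shear_w, sum_w, W. split. lra.
  rewrite <- Hi, <- R1. apply surjective_pairing.
Qed.
End Convolution.

(** * Recovering h and g from the hypotheses *)

Lemma Cexp_Ci t : Cexp (Ci * RtoC t)%C = (cos t, sin t).
Proof.
replace (Ci * RtoC t)%C with ((0, t) : C) by (apply injective_projections; simpl; ring).
unfold Cexp; simpl. rewrite exp_0. apply injective_projections; simpl; ring.
Qed.

Lemma Cexp_minus_Ci t : Cexp (- (Ci * RtoC t))%C = (cos t, - sin t).
Proof.
replace (- (Ci * RtoC t))%C with (Ci * RtoC (- t))%C by (rewrite RtoC_opp; ring).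
now rewrite Cexp_Ci, cos_neg, sin_neg.
Qed.

Lemma cos2_sin2 t : cos t ^ 2 + sin t ^ 2 = 1.
Proof. rewrite <- (sin2_cos2 t). unfold Rsqr. ring. Qed.

Lemma Cmod_Cexp_Ci t : Cmod (Cexp (Ci * RtoC t))%C = 1.
Proof. rewrite Cexp_Ci. apply Cmod_k, cos2_sin2. Qed.

(** Differentiate exp(L) = u. *)
Lemma log_branch_derivative u L z l : is_log_branch u L -> E z -> has_cderiv u z l ->
  (C_derive L z * u z = l)%C.
Proof.
intros [HL [_ HE]] Hz Hu.
pose proof (ex_derive_has_cderiv _ _ (HL z Hz)) as D.
pose proof (has_cderiv_comp _ _ _ _ _ (has_cderiv_Cexp (L z)) D) as D1.
rewrite HE in D1 by auto.
pose proof (has_cderiv_ext_E _ u _ _ Hz HE D1) as D2.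
rewrite <- (has_cderiv_C_derive _ _ _ Hu), (has_cderiv_C_derive _ _ _ D2). ring.
Qed.

Lemma log_quotient_derivative k1 k2 L z : Cmod k1 = 1 -> Cmod k2 = 1 ->
  is_log_branch (fun z => (1 + z * k1) / (1 + z * k2))%C L -> E z ->
  C_derive L z = ((k1 - k2) / ((1 + k1 * z) * (1 + k2 * z)))%C.
Proof.
intros H1 H2 HL Hz.
pose proof (linear_plus_neq_0 k1 z H1 Hz) as N1. pose proof (linear_plus_neq_0 k2 z H2 Hz) as N2.
rewrite Cmult_comm in N1, N2.
assert (D : forall al, has_cderiv (fun z => 1 + z * al)%C z al).
{ intros al. apply (has_cderiv_ext_ball (fun z => 1 + al * z)%C _ _ _ 1). lra. intros; ring.
  apply has_cderiv_linear_factor. }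
pose proof (log_branch_derivative _ _ _ _ HL Hz (has_cderiv_div (fun z => 1 + z * k1)%C (fun z => 1 + z * k2)%C z _ _ N2 (D k1) (D k2))) as Q.
cbv beta in Q.
replace (C_derive L z) with (C_derive L z * ((1 + z * k1) / (1 + z * k2)) * ((1 + z * k2) / (1 + z * k1)))%C by (field; auto).
rewrite Q. rewrite !(Cmult_comm _ z). field. auto.
Qed.

Lemma hadamard_half_plane (c a : R) f p z : a = c - 1 / 2 -> is_pser p f -> f (RtoC 0) = RtoC 0 -> E z ->
  hadamard (fun z => (RtoC c * z - RtoC (1 / 2) * z ^ 2) / (RtoC 1 - z) ^ 2)%C f z
   = (RtoC a * (z * C_derive f z) + RtoC (1 / 2) * f z)%C.
Proof.
intros -> Hf Hf0 Hz. apply (hadamard_affine _ f p); auto.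
intros n. rewrite taylor_half_plane, RtoC_minus. reflexivity.
Qed.

Theorem theorem2p3 (beta theta a : R) (h g L : C -> C)
  (Hbeta : 0 < beta < PI)
  (HL : is_log_branch
          (fun z => (RtoC 1 + z * Cexp (Ci * RtoC beta)) /
                    (RtoC 1 + z * Cexp (- (Ci * RtoC beta))))%C L)
  (Hf : KH0 h g)
  (Hsum : forall z : C, E z ->
     (h z + g z)%C = (RtoC 1 / (RtoC 2 * Ci * RtoC (sin beta)) * L z)%C)
  (Hdil : forall z : C, E z ->
     (C_derive g z / C_derive h z)%C = (Cexp (Ci * RtoC theta) * z)%C)
  (Ha_range : - (1 / 3) <= a < 1) :
  SH0 (scale (1 + a) (hadamard (Ha a) h)) (scale (1 + a) (hadamard (Ga a) g)) /\
  convex_in_real_direction (hconv (Ha a) (Ga a) h g).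
Proof.
destruct Hf as [[[ah ag h0 g0 sp _ hn] _] _].
set (c := cos beta). set (s := sin beta).
assert (Hcs : c ^ 2 + s ^ 2 = 1) by apply cos2_sin2.
assert (Hs : 0 < s) by (apply sin_gt_0; lra).
set (eps := Cexp (Ci * RtoC theta)%C) in *.
assert (Heps : Cmod eps = 1) by apply Cmod_Cexp_Ci.
rewrite Cexp_Ci, Cexp_minus_Ci in HL. fold c s in HL. fold s in Hsum.
set (k := (c, s) : C) in *. set (k' := (c, - s) : C) in *.
set (h1 := fun z => (1 / (1 + k * z) / (1 + k' * z) / (1 + eps * z))%C).
set (lam := (1 - a) / (2 * (1 + a))).
assert (Hlam : 0 < lam <= 2 * (1 / 2)).
{ unfold lam. split. apply Rdiv_lt_0_compat; lra.
  apply Rmult_le_reg_r with (2 * (1 + a)). lra. unfold Rdiv at 1. rewrite Rmult_assoc, Rinv_l; lra. }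
assert (Dh : forall z, E z -> C_derive h z = h1 z /\ C_derive g z = (eps * (z * h1 z))%C).
{ intros z Hz.
  pose proof (ex_derive_has_cderiv _ _ (ah z Hz)) as Dh. pose proof (ex_derive_has_cderiv _ _ (ag z Hz)) as Dg.
  assert (Nh : C_derive h z <> RtoC 0).
  { apply Cmod_gt_0. eapply Rle_lt_trans. 2: exact (sp z Hz). apply Cmod_ge_0. }
  assert (Qg : C_derive g z = (eps * z * C_derive h z)%C) by (rewrite <- Hdil by auto; field; auto).
  pose proof (linear_plus_neq_0 k z (Cmod_k c s Hcs) Hz) as N1.
  pose proof (linear_plus_neq_0 k' z (Cmod_k' c s Hcs) Hz) as N2.
  pose proof (linear_plus_neq_0 eps z Heps Hz) as N3.
  assert (Qs : (C_derive h z + C_derive g z)%C = (1 / ((1 + k * z) * (1 + k' * z)))%C).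
  { pose proof (has_cderiv_ext_E _ _ _ _ Hz Hsum (has_cderiv_plus _ _ _ _ _ Dh Dg)) as D1.
    rewrite <- (has_cderiv_C_derive _ _ _ D1).
    pose proof (has_cderiv_scal (1 / (2 * Ci * RtoC s))%C _ _ _ (ex_derive_has_cderiv _ _ (proj1 HL z Hz))) as D2.
    rewrite (has_cderiv_C_derive _ _ _ D2).
    rewrite (log_quotient_derivative k k' L z (Cmod_k c s Hcs) (Cmod_k' c s Hcs) HL Hz).
    unfold k at 1, k' at 1. rewrite (k_minus_k' c s). fold k k'. field.
    repeat split; auto; intros Z; first [apply (f_equal fst) in Z; simpl in Z; lra | apply (f_equal snd) in Z; simpl in Z; lra]. }
  assert (Qh : C_derive h z = h1 z).
  { unfold h1. replace (C_derive h z) with ((C_derive h z + C_derive g z) / (1 + eps * z))%C by (rewrite Qg; field; auto).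
    rewrite Qs. field. auto. }
  split; auto. rewrite Qg, Qh. ring. }
assert (Hh : forall z, E z -> has_cderiv h z (h1 z)).
{ intros z Hz. rewrite <- (proj1 (Dh z Hz)). now apply ex_derive_has_cderiv, ah. }
assert (Hg : forall z, E z -> has_cderiv g z (eps * (z * h1 z))%C).
{ intros z Hz. rewrite <- (proj2 (Dh z Hz)). now apply ex_derive_has_cderiv, ag. }
destruct (h1_pser c s eps Hcs Heps) as [a1 P1]. fold k k' h1 in P1.
destruct (is_pser_antiderivative _ h _ P1 h0 Hh) as [ph Ph].
destruct (is_pser_antiderivative _ g _ (is_pser_scal eps _ _ (is_pser_mulz _ _ P1)) g0 Hg) as [pg Pg].
set (cH := convH c s lam (1 / 2) eps h). set (cG := convG c s lam (1 / 2) eps g).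
assert (EH : forall z, E z -> hadamard (Ha a) h z = cH z).
{ intros z Hz. unfold Ha. rewrite (hadamard_half_plane _ lam h ph); auto.
  rewrite (proj1 (Dh z Hz)). reflexivity. unfold lam. field. lra. }
assert (EG : forall z, E z -> hadamard (Ga a) g z = cG z).
{ intros z Hz. unfold Ga. rewrite (hadamard_half_plane _ (- lam) g pg); auto.
  rewrite (proj2 (Dh z Hz)), RtoC_opp. reflexivity. unfold lam. field. lra. }
assert (EF : forall z, E z -> hconv (Ha a) (Ga a) h g z = harm cH cG z).
{ intros z Hz. unfold hconv, harm. now rewrite EH, EG. }
assert (Hpos : 0 < 1 + a) by lra.
pose proof (fun z Hz => has_cderiv_ext_E _ _ _ _ Hz (fun y Hy => f_equal (Cmult (RtoC (1 + a))) (eq_sym (EH y Hy)))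
  (has_cderiv_scal (RtoC (1 + a)) _ _ _ (convH_derive c s lam (1 / 2) eps h Hcs Heps Hh z Hz))) as DH.
pose proof (fun z Hz => has_cderiv_ext_E _ _ _ _ Hz (fun y Hy => f_equal (Cmult (RtoC (1 + a))) (eq_sym (EG y Hy)))
  (has_cderiv_scal (RtoC (1 + a)) _ _ _ (convG_derive c s lam (1 / 2) eps g Hcs Heps Hg z Hz))) as DG.
fold (scale (1 + a) (hadamard (Ha a) h)) in DH. fold (scale (1 + a) (hadamard (Ga a) g)) in DG.
split.
- split; [split|].
  + intros z Hz. eexists. apply has_cderiv_is_derive. exact (DH z Hz).
  + intros z Hz. eexists. apply has_cderiv_is_derive. exact (DG z Hz).
  + unfold scale. rewrite EH by apply E_0. unfold cH, convH. rewrite h0. ring.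
  + unfold scale. rewrite EG by apply E_0. unfold cG, convG. rewrite g0. ring.
  + intros z Hz. rewrite (has_cderiv_C_derive _ _ _ (DH z Hz)), (has_cderiv_C_derive _ _ _ (DG z Hz)).
    rewrite !(Cmod_mult (RtoC (1 + a))). apply Rmult_lt_compat_l.
    rewrite Cmod_R, Rabs_pos_eq; lra.
    exact (conv_sense_preserving c s lam (1 / 2) eps Hcs Hlam Heps z Hz).
  + intros z w Hz Hw Heq.
    apply (conv_univalent c s lam (1 / 2) eps h g Hcs Hs Hlam Heps Hh Hg z w Hz Hw).
    unfold harm, scale in *. rewrite !EH, !EG in Heq by auto. fold cH cG.
    assert (N : RtoC (1 + a) <> RtoC 0) by (intros Z; apply RtoC_inj in Z; lra).
    assert (S : forall y, (cH y + Cconj (cG y))%C = (/ RtoC (1 + a) * (RtoC (1 + a) * cH y + Cconj (RtoC (1 + a) * cG y)))%C).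
    { intros y. replace (Cconj (RtoC (1 + a) * cG y)) with (RtoC (1 + a) * Cconj (cG y))%C.
      field; auto. generalize (cG y). intros [u v]. apply injective_projections; simpl; ring. }
    rewrite (S z), (S w), Heq. reflexivity.
  + rewrite (has_cderiv_C_derive _ _ _ (DH _ E_0)).
    rewrite (convH_derive_at_0 c s lam (1 / 2) eps), <- RtoC_mult. f_equal. unfold lam. field. lra.
  + rewrite (has_cderiv_C_derive _ _ _ (DG _ E_0)).
    match goal with |- Cconj ?u = _ => replace u with (RtoC 0) by ring end.
    apply injective_projections; simpl; ring.
- unfold convex_in_real_direction. intros p.
  eapply connected_set_ext. 2: exact (conv_convex_real c s lam (1 / 2) eps h g Hcs Hs Hlam Heps Hh Hg p).
  intros v. fold cH cG.
  split; intros [[z [Hz <-]] Hl]; (split; [exists z; split; auto | ]); rewrite ?EF in * by auto; auto.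
Qed.
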